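(* Let $\Lambda$ be an artin algebra and let $\mathcal{P}^{<\infty}:=\{M\in\mathrm{mod}\,\Lambda\mid \mathrm{pd}\,M<\infty\}$. The following statements are equivalent. (1) $\mathrm{fin.dim}\,\Lambda<\infty$. (2) There exists some $n\geq 0$ such that $\mathbf{size}_{\mathrm{mod}\,\Lambda}\,\Omega^{n}(\mathcal{P}^{<\infty})\leq 1$.
   Context: $\mathrm{mod}\,\Lambda$ is the category of finitely generated right $\Lambda$-modules; $\mathrm{pd}\,M$ is the projective dimension of $M$. The finitistic dimension is $\mathrm{fin.dim}\,\Lambda:=\sup\{\mathrm{pd}\,M\mid M\in\mathcal{P}^{<\infty}\}$. For $M\in\mathrm{mod}\,\Lambda$, $\Omega^0(M)=M$, $\Omega^1(M)$ is the kernel of a projective cover $P\to M$, and $\Omega^n(M)=\Omega^1(\Omega^{n-1}(M))$; for a class $\mathcal{X}$ of modules, $\Omega^n(\mathcal{X}):=\{\Omega^n(M)\mid M\in\mathcal{X}\}$. Let $\mathcal{A}$ be an abelian category. For a class $\mathcal{U}$ of objects, $\mathrm{add}\,\mathcal{U}$ is the full subcategory of direct summands of finite direct sums of objects of $\mathcal{U}$. For subcategories $\mathcal{U}_1,\mathcal{U}_2$, $\mathcal{U}_1\diamond\mathcal{U}_2:=\mathrm{add}\{A\in\mathcal{A}\mid \text{there is an exact sequence } 0\to U_1\to A\to U_2\to 0 \text{ with } U_1\in\mathcal{U}_1, U_2\in\mathcal{U}_2\}$. For $T\in\mathcal{A}$: $\langle T\rangle_0=0$, $\langle T\rangle_1=\mathrm{add}\,T$,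 $\langle T\rangle_n=\langle T\rangle_1\diamond\langle T\rangle_{n-1}$ for $n\ge 2$. For a class $\mathcal{X}$ of objects of $\mathcal{A}$, $\mathbf{size}_{\mathcal{A}}\mathcal{X}:=\inf\{n\ge 0\mid \mathcal{X}\subseteq\langle T\rangle_{n+1}\text{ for some }T\in\mathcal{A}\}$ (with $\inf\emptyset=+\infty$). *)

(* Defs.v *)
From mathcomp Require Import all_boot all_order all_algebra.
From mathcomp Require Import boolp classical_sets constructive_ereal.
Set Implicit Arguments.
Unset Strict Implicit.
Unset Printing Implicit Defensive.
Import Order.TTheory GRing.Theory Num.Theory.
Local Open Scope classical_set_scope.
Local Open Scope ring_scope.

(* Infimum in {0, 1, ..., +oo} of a set of naturals; inf of set0 is +oo. *)
Definition inf_nat (S : set nat) : \bar int :=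
  if pselect (exists n, `[< S n >]) is left ex_S
  then ((ex_minn ex_S)%:Z)%:E else +oo%E.

(* Supremum in {0, 1, ..., +oo}, as the least upper bound there. *)
Definition sup_enat (S : set (\bar int)) : \bar int :=
  inf_nat [set n : nat | forall x, S x -> (x <= n%:Z%:E)%E].

(* Descending chain condition on ideals.  Boolean predicates represent all
   subsets, thanks to the excluded middle of boolp. *)
Definition artinian (R : comPzRingType) : Prop :=
  forall I : nat -> {pred R^o},
    (forall n, GRing.submod_closed (I n)) ->
    (forall n, {subset I n.+1 <= I n}) ->
    exists N, forall n, (N <= n)%N -> I n =i I N.

(* L is an R-algebra through phi : R -> L with central image.  This is used
   instead of algType, which would rule out the zero algebra. *)
Definition artin_algebra (R : comPzRingType) (L : pzRingType)
    (phi : {rmorphism R -> L}) : Prop :=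
  [/\ artinian R,
      forall r x, phi r * x = x * phi r
    & exists n (e : 'I_n -> L), forall x : L,
        exists c : 'I_n -> R, x = \sum_(i < n) phi (c i) * e i].

(* The module-theoretic notions below are for left modules over A; right
   L-modules are left modules over the converse ring A := L^c.  Objects
   are considered up to isomorphism, as linear_iso makes precise. *)

(* Not a classical set: lmodType A is too large a type. *)
Definition mod_class (A : pzRingType) := lmodType A -> Prop.

Definition linear_iso (A : pzRingType) (M N : lmodType A) : Prop :=
  exists f : {linear M -> N}, bijective f.

Definition short_exact (A : pzRingType) (K M N : lmodType A)
    (f : {linear K -> M}) (g : {linear M -> N}) : Prop :=
  [/\ injective f, range f = g @^-1` [set 0] & range g = setT].

Definition fin_gen (A : pzRingType) : mod_class A :=
  fun M => exists n (e : 'I_n -> M), forall x : M,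
    exists c : 'I_n -> A, x = \sum_(i < n) c i *: e i.

Definition projective (A : pzRingType) (P : lmodType A) : Prop :=
  forall (M N : lmodType A) (g : {linear M -> N}) (f : {linear P -> N}),
    range g = setT -> exists h : {linear P -> M}, g \o h =1 f.

(* An essential epimorphism from a projective module. *)
Definition projective_cover (A : pzRingType) (P M : lmodType A)
    (g : {linear P -> M}) : Prop :=
  [/\ projective P, range g = setT
    & forall (X : lmodType A) (h : {linear X -> P}),
        range (g \o h) = setT -> range h = setT].

(* M has a projective resolution 0 -> P_n -> ... -> P_0 -> M -> 0. *)
Fixpoint proj_resolution (A : pzRingType) (n : nat) (M : lmodType A) : Prop :=
  if n is m.+1 then
    exists (P K : lmodType A) (f : {linear K -> P}) (g : {linear P -> M}),
      [/\ projective P, short_exact f g & proj_resolution m K]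
  else projective M.

(* The zero module gets projective dimension 0. *)
Definition pd (A : pzRingType) (M : lmodType A) : \bar int :=
  inf_nat [set n | proj_resolution n M].

(* K is isomorphic to Omega^1(M). *)
Definition is_syzygy (A : pzRingType) (M K : lmodType A) : Prop :=
  exists (P : lmodType A) (f : {linear K -> P}) (g : {linear P -> M}),
    projective_cover g /\ short_exact f g.

(* N is isomorphic to Omega^n(M). *)
Fixpoint is_nth_syzygy (A : pzRingType) (n : nat) (M N : lmodType A) : Prop :=
  if n is m.+1 then
    exists2 K : lmodType A, is_nth_syzygy m M K & is_syzygy K N
  else linear_iso M N.

Definition Omega (A : pzRingType) (n : nat) (X : mod_class A) : mod_class A :=
  fun N => exists2 M, X M & is_nth_syzygy n M N.

(* The direct sum of F 0, ..., F n.-1. *)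
Fixpoint dsum (A : pzRingType) (F : nat -> lmodType A) (n : nat) : lmodType A :=
  if n is m.+1 then (dsum F m * F m)%type else 'rV[A]_0.

(* In add and diamond the ambient abelian category is that of the finitely
   generated modules. *)
Definition add (A : pzRingType) (U : mod_class A) : mod_class A :=
  fun M => fin_gen M /\
    exists n (F : nat -> lmodType A), (forall i, (i < n)%N -> U (F i)) /\
      exists N : lmodType A, linear_iso (M * N)%type (dsum F n).

Definition diamond (A : pzRingType) (U1 U2 : mod_class A) : mod_class A :=
  add (fun M => fin_gen M /\
    exists (M1 M2 : lmodType A) (f : {linear M1 -> M}) (g : {linear M -> M2}),
      [/\ U1 M1, U2 M2 & short_exact f g]).

(* The class <T>_n. *)
Fixpoint layer (A : pzRingType) (T : lmodType A) (n : nat) : mod_class A :=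
  match n with
  | 0 => fun M => forall x : M, x = 0
  | 1 => add (eq T)
  | m.+1 => diamond (add (eq T)) (layer T m)
  end.

(* size_{mod L} *)
Definition size_mod (L : pzRingType) (X : mod_class L^c) : \bar int :=
  inf_nat [set n | exists2 T : lmodType L^c,
                     fin_gen T & forall M, X M -> layer T n.+1 M].

(* P^{<oo}, for right L-modules *)
Definition Pfin (L : pzRingType) : mod_class L^c :=
  fun M => fin_gen M /\ (pd M < +oo)%E.

Definition fin_dim (L : pzRingType) : \bar int :=
  sup_enat [set x | exists2 M : lmodType L^c, Pfin M & x = pd M].

(* Main.v *)
Require Import Defs.
From HB Require Import structures.
From mathcomp Require Import all_boot all_order all_algebra.
From mathcomp Require Import boolp classical_sets constructive_ereal.
Set Implicit Arguments.
Unset Strict Implicit.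
Unset Printing Implicit Defensive.
Import Order.TTheory GRing.Theory Num.Theory.
Local Open Scope ring_scope.

(* If fin.dim is m, then Omega^(m+1) vanishes on P^(<oo).

   Conversely, let Y in P^(<oo) be a summand of X, where 0 -> U -> X -> V -> 0
   is exact with U and V in add T; up to enlarging X, U and V are powers of T.
   Then 0 -> D -> B -> X -> 0 is exact with D a power of Omega T and B the sum of
   a power of T and a projective.  Let e be the projection of X onto Y.  The
   obstruction to lifting e to an endomorphism of this sequence is a map
   Omega B -> D killed by some power of Omega, since pd Y < oo.  The maps
   Omega T -> Omega T killed by Omega^k form an ascending chain of submodules of a
   noetherian R-module, so a power of Omega depending only on T kills the
   obstruction.  Hence after boundedly many syzygies e lifts, and the Fitting
   decompositions of e and of its lifts split the sequence: there remains
   0 -> D' -> B' -> W -> 0 with D' and B' summands of powers of a fixed module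
   S, and it suffices to bound pd W, which is finite.

   This is done as by Igusa and Todorov.  D' and B' are given by vectors of
   multiplicities of the indecomposable summands of S.  The pairs of vectors
   that become equal in the split Grothendieck group of some category of
   syzygies form a subtractive submonoid of N^q, which Dickson's lemma shows to
   be finitely generated.  So after boundedly many syzygies, and after adding a
   common summand, the sequence reads 0 -> K -> K + P -> W' -> 0 with P
   projective and K a summand of a power of a fixed module.  By Fitting's lemma
   one may assume that K -> K is nilpotent; it is invertible in high syzygies
   since pd W' < oo, so pd K < oo.  Finally pd K is bounded by the same chain
   argument as above, now applied to the endomorphisms of the fixed module. *)

(** * Linear maps, direct summands and projective modules *)

Section LinearMaps.
Context {A : pzRingType}.
Implicit Types K M N P Q : lmodType A.

Definition mklin M N (f : M -> N) (f_lin : linear f) : {linear M -> N} :=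
  HB.pack f (GRing.isLinear.Build A M N _ f f_lin).

Definition lid M : {linear M -> M} := idfun.
Definition lcomp M N P (g : {linear N -> P}) (f : {linear M -> N}) :
  {linear M -> P} := g \o f.
Definition ladd M N (f g : {linear M -> N}) : {linear M -> N} := f \+ g.
Definition lopp M N (f : {linear M -> N}) : {linear M -> N} := \- f.
Definition lzero M N : {linear M -> N} := \0.
Definition lfst M N : {linear (M * N)%type -> M} := fst.
Definition lsnd M N : {linear (M * N)%type -> N} := snd.

Fact lpair_subproof M N P (f : {linear M -> N}) (g : {linear M -> P}) :
  linear (fun x => (f x, g x)).
Proof. by move=> a x y; rewrite !linearP. Qed.
Definition lpair M N P (f : {linear M -> N}) (g : {linear M -> P}) :
  {linear M -> (N * P)%type} := mklin (lpair_subproof f g).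

Definition linl M N : {linear M -> (M * N)%type} := lpair (lid M) (lzero M N).
Definition linr M N : {linear N -> (M * N)%type} := lpair (lzero N M) (lid N).
Definition lcopair M N P (f : {linear M -> P}) (g : {linear N -> P}) :
  {linear (M * N)%type -> P} := ladd (lcomp f (lfst M N)) (lcomp g (lsnd M N)).
Definition lprod M N M' N' (f : {linear M -> M'}) (g : {linear N -> N'}) :
  {linear (M * N)%type -> (M' * N')%type} :=
  lpair (lcomp f (lfst M N)) (lcomp g (lsnd M N)).

Fact iter_subproof M (f : {linear M -> M}) n : linear (iter n f).
Proof. by elim: n => [|n IH] a x y //=; rewrite IH linearP. Qed.
Definition liter M n (f : {linear M -> M}) : {linear M -> M} :=
  mklin (iter_subproof f n).

Definition onto (T U : Type) (g : T -> U) := forall y, exists x, g x = y.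

Lemma ontoP (T U : Type) (g : T -> U) : range g = setT <-> onto g.
Proof.
split=> [gT y|gT]; last by apply/seteqP; split=> // y _; case: (gT y) => x; exists x.
have [x _ <-] : range g y by rewrite gT.
by exists x.
Qed.

Lemma short_exactP K M N (f : {linear K -> M}) (g : {linear M -> N}) :
  short_exact f g <->
  [/\ injective f, forall x, g (f x) = 0,
      forall y, g y = 0 -> exists x, f x = y & onto g].
Proof.
split=> [[fi fg gT]|[fi gf0 fg gT]].
  split=> //; last exact/ontoP.
    by move=> x; suff : (g @^-1` [set 0])%classic (f x) by []; rewrite -fg; exists x.
  move=> y gy; have [x _ <-] : range f y by rewrite fg.
  by exists x.
split=> //; last exact/ontoP.
apply/seteqP; split=> y /=; first by case=> x _ <-; apply: gf0.
by move=> /fg[x <-]; exists x.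
Qed.

Lemma inj0 M N (f : {linear M -> N}) :
  (forall x, f x = 0 -> x = 0) -> injective f.
Proof.
by move=> f0 x y /eqP; rewrite -subr_eq0 -linearB => /eqP/f0/eqP; rewrite subr_eq0 => /eqP.
Qed.

(** Choice supplies a map of sets, and injectivity of [i] forces it to be linear. Many maps below
    come from a pointwise statement in this way. *)
Lemma linear_lift K M N (i : {linear K -> M}) (h : {linear N -> M}) :
  injective i -> (forall x, exists y, i y = h x) ->
  exists k : {linear N -> K}, forall x, i (k x) = h x.
Proof.
move=> i_inj /choice[k kE].
suff k_lin : linear k by exists (mklin k_lin).
by move=> a x y; apply: i_inj; rewrite kE !linearP !kE.
Qed.

Definition submod M (S : set M) :=
  S 0 /\ forall a x y, S x -> S y -> S (a *: x + y).

Definition sub_pred M (S : set M) : {pred M} := fun x => `[< S x >].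

Fact sub_pred_closed M (S : set M) : submod S -> GRing.submod_closed (sub_pred S).
Proof.
case=> S0 Sl; split; first exact/asboolP.
by move=> a x y /asboolP Sx /asboolP Sy; apply/asboolP/Sl.
Qed.

(** The proof [S_sub] is a parameter of the type so that instance inference can recover closure from
    it. *)
Definition submod_type M (S : set M) (S_sub : submod S) : Type :=
  {x : M | sub_pred S x}.

Section SubModule.
Variables (M : lmodType A) (S : set M) (S_sub : submod S).
HB.instance Definition _ :=
  GRing.isSubmodClosed.Build A M (sub_pred S) (sub_pred_closed S_sub).
HB.instance Definition _ := SubType.copy (submod_type S_sub) {x : M | sub_pred S x}.
HB.instance Definition _ := [Choice of submod_type S_sub by <:].
HB.instance Definition _ :=
  [SubChoice_isSubLmodule of submod_type S_sub by <:].
End SubModule.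

Lemma submod_ex M (S : set M) : submod S ->
  exists (K : lmodType A) (f : {linear K -> M}),
    injective f /\ forall x, S x <-> exists y, f y = x.
Proof.
move=> S_sub; pose K : lmodType A := submod_type S_sub.
exists K, (val : {linear K -> M}); split; first exact: val_inj.
move=> x; split=> [Sx|[[y yP] /= <-]]; last exact/asboolP.
by exists (exist _ x (asboolT Sx)).
Qed.

Lemma ker_submod M N (f : {linear M -> N}) : submod (fun x => f x = 0).
Proof.
by split=> [|a x y fx fy]; rewrite ?linear0 // linearP fx fy scaler0 addr0.
Qed.

Lemma range_submod M N (f : {linear M -> N}) : submod (fun y => exists x, f x = y).
Proof.
split=> [|a _ _ [x <-] [y <-]]; first by exists 0; rewrite linear0.
by exists (a *: x + y); rewrite linearP.
Qed.

Lemma ker_ex P M (g : {linear P -> M}) : onto g ->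
  exists (K : lmodType A) (f : {linear K -> P}), short_exact f g.
Proof.
move=> g_onto; have [K [f [f_inj fE]]] := submod_ex (ker_submod g).
by exists K, f; apply/short_exactP; split=> // [x|y /fE //]; apply/fE; exists x.
Qed.

Lemma split_iso K M N (f : {linear K -> M}) (g : {linear M -> N})
    (s : {linear N -> M}) :
  short_exact f g -> (forall x, g (s x) = x) -> linear_iso M (K * N)%type.
Proof.
move=> /short_exactP[f_inj gf0 gf _] gs.
have /(linear_lift f_inj)[r rE] :
    forall x, exists y, f y = ladd (lid M) (lopp (lcomp s g)) x.
  by move=> x; apply: gf; rewrite /= linearB /= gs subrr.
have rf y : r (f y) = y by apply: f_inj; rewrite rE /= gf0 linear0 oppr0 addr0.
have rs y : r (s y) = 0.
  by apply: f_inj; rewrite rE /= gs linear0 subrr.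
exists (lpair r g); exists (lcopair f s) => [x|[y z]] /=.
  by rewrite rE /= addrNK.
by rewrite !linearD /= rf rs gf0 gs add0r addr0.
Qed.

Lemma liso_mk M N (f : {linear M -> N}) (g : {linear N -> M}) :
  cancel f g -> cancel g f -> linear_iso M N.
Proof. by move=> fK gK; exists f; exists g. Qed.

Lemma liso_ex M N : linear_iso M N ->
  exists (f : {linear M -> N}) (g : {linear N -> M}), cancel f g /\ cancel g f.
Proof.
move=> [f [g fK gK]].
have g_lin : linear g by move=> a x y; apply: (can_inj fK); rewrite linearP !gK.
by exists f, (mklin g_lin).
Qed.

Lemma liso_bij M N (f : {linear M -> N}) : injective f -> onto f -> linear_iso M N.
Proof.
move=> f_inj f_onto.
have /(linear_lift f_inj)[g gE] : forall y, exists x, f x = lid N y by [].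
by apply: (@liso_mk _ _ f g) => // x; apply: f_inj; rewrite gE.
Qed.

Lemma liso_refl M : linear_iso M M.
Proof. exact: (@liso_mk _ _ (lid M) (lid M)). Qed.

Lemma liso_sym M N : linear_iso M N -> linear_iso N M.
Proof. by move=> /liso_ex[f [g [fK gK]]]; apply: (liso_mk gK fK). Qed.

Lemma liso_trans M N P : linear_iso M N -> linear_iso N P -> linear_iso M P.
Proof.
move=> /liso_ex[f [g [fK gK]]] /liso_ex[f' [g' [fK' gK']]].
by apply: (@liso_mk _ _ (lcomp f' f) (lcomp g g')) => x /=; rewrite ?fK' ?gK.
Qed.

Lemma liso_prod M N M' N' :
  linear_iso M M' -> linear_iso N N' -> linear_iso (M * N)%type (M' * N')%type.
Proof.
move=> /liso_ex[f [g [fK gK]]] /liso_ex[f' [g' [fK' gK']]].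
apply: (@liso_mk _ _ (lprod f f') (lprod g g')) => -[x y] /=.
  by rewrite fK fK'.
by rewrite gK gK'.
Qed.

Lemma liso_prodC M N : linear_iso (M * N)%type (N * M)%type.
Proof.
by apply: (@liso_mk _ _ (lpair (lsnd M N) (lfst M N)) (lpair (lsnd N M) (lfst N M))) => -[].
Qed.

Lemma liso_prodA M N P :
  linear_iso (M * (N * P))%type ((M * N) * P)%type.
Proof.
pose p1 := lfst M (N * P)%type; pose p2 := lsnd M (N * P)%type.
pose q1 := lfst (M * N)%type P; pose q2 := lsnd (M * N)%type P.
by apply: (@liso_mk _ _ (lpair (lpair p1 (lcomp (lfst N P) p2)) (lcomp (lsnd N P) p2))
  (lpair (lcomp (lfst M N) q1) (lpair (lcomp (lsnd M N) q1) q2))) => [[x []]|[[]]].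
Qed.

Lemma liso_prodACA M N P Q :
  linear_iso ((M * N) * (P * Q))%type ((M * P) * (N * Q))%type.
Proof.
apply: liso_trans (liso_prodA _ _ _) _; apply: liso_sym.
apply: liso_trans (liso_prodA _ _ _) _; apply: liso_prod; last exact: liso_refl.
apply: liso_trans (liso_sym (liso_prodA _ _ _)) _.
apply: liso_trans (liso_prod (liso_refl _) (liso_prodC _ _)) (liso_prodA _ _ _).
Qed.

Definition zero_mod M := forall x : M, x = 0.

Lemma zero_rV0 : zero_mod 'rV[A]_0.
Proof. by move=> x; apply/rowP; case. Qed.

Lemma liso_zero M N : zero_mod M -> zero_mod N -> linear_iso M N.
Proof.
move=> M0 N0; apply: (@liso_mk _ _ (lzero M N) (lzero N M)) => x.
  by rewrite (M0 x) linear0.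
by rewrite (N0 x) linear0.
Qed.

Lemma liso_prodr0 M N : zero_mod N -> linear_iso (M * N)%type M.
Proof.
move=> N0; apply: (@liso_mk _ _ (lfst M N) (linl M N)) => [[x y]|x] //=.
by rewrite (N0 y).
Qed.

Lemma proj_lift P M N (g : {linear M -> N}) (f : {linear P -> N}) :
  projective P -> onto g -> exists h : {linear P -> M}, forall x, g (h x) = f x.
Proof. by move=> P_proj /ontoP g_onto; apply: P_proj. Qed.

Definition retract N M := exists (i : {linear N -> M}) (r : {linear M -> N}),
  cancel i r.

Lemma retract_iso M N : linear_iso M N -> retract M N.
Proof. by move=> /liso_ex[f [g [fK _]]]; exists f, g. Qed.

Lemma retract_trans M N P : retract M N -> retract N P -> retract M P.
Proof.
move=> [i [r ir]] [i' [r' ir']]; exists (lcomp i' i), (lcomp r r') => x /=.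
by rewrite ir'.
Qed.

Lemma retract_refl M : retract M M.
Proof. by exists (lid M), (lid M). Qed.

Lemma retract_prod M N M' N' : retract M M' -> retract N N' ->
  retract (M * N)%type (M' * N')%type.
Proof.
move=> [i [r ir]] [i' [r' ir']]; exists (lprod i i'), (lprod r r') => -[x y] /=.
by rewrite ir ir'.
Qed.

Lemma retractl M N : retract M (M * N)%type.
Proof. by exists (linl M N), (lfst M N). Qed.

Lemma retractr M N : retract N (M * N)%type.
Proof. by exists (linr M N), (lsnd M N). Qed.

Lemma retract_compl M N : retract M N ->
  exists C : lmodType A, linear_iso N (M * C)%type.
Proof.
move=> [i [r ir]].
have r_onto : onto r by move=> x; exists (i x).
have [C [f fr]] := ker_ex r_onto.
by exists C; apply: liso_trans (split_iso fr ir) (liso_prodC _ _).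
Qed.

Lemma proj_retract N P : retract N P -> projective P -> projective N.
Proof.
move=> [i [r ir]] P_proj M M' g f g_onto.
have [h hE] := P_proj _ _ g (lcomp f r) g_onto.
by exists (lcomp h i) => x; rewrite /= -[LHS]/((g \o h) (i x)) hE /= ir.
Qed.

Lemma proj_prod P Q : projective P -> projective Q -> projective (P * Q)%type.
Proof.
move=> P_proj Q_proj M N g f g_onto.
have [h hE] := P_proj _ _ g (lcomp f (linl P Q)) g_onto.
have [k kE] := Q_proj _ _ g (lcomp f (linr P Q)) g_onto.
exists (lcopair h k) => -[x y] /=.
rewrite linearD -[g (h x)]/((g \o h) x) -[g (k y)]/((g \o k) y) hE kE /=.
by rewrite -linearD; congr (f _); congr pair; rewrite ?addr0 ?add0r.
Qed.

Lemma proj_split P K M (f : {linear K -> M}) (g : {linear M -> P}) :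
  projective P -> short_exact f g -> linear_iso M (K * P)%type.
Proof.
move=> P_proj fg; have [_ _ _ g_onto] := (short_exactP _ _).1 fg.
by have [s sE] := proj_lift (lid P) P_proj g_onto; apply: split_iso fg sE.
Qed.

Fact free_subproof M n (e : 'I_n -> M) :
  linear (fun c : 'rV[A]_n => \sum_i c 0 i *: e i).
Proof.
move=> a x y; rewrite scaler_sumr -big_split /=; apply: eq_bigr => i _.
by rewrite !mxE scalerDl scalerA.
Qed.
Definition lfree M n (e : 'I_n -> M) := mklin (free_subproof e).

Lemma lfreeE M n (f : {linear 'rV[A]_n -> M}) (x : 'rV_n) :
  f x = lfree (fun i => f (delta_mx 0 i)) x.
Proof.
rewrite {1}(row_sum_delta x) linear_sum; apply: eq_bigr => i _.
exact: linearZ_LR.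
Qed.

Lemma proj_free n : projective 'rV[A]_n.
Proof.
move=> M N g f /ontoP g_onto.
have [s sE] := choice (fun i => g_onto (f (delta_mx 0 i))).
exists (lfree s) => x; rewrite (lfreeE f) (lfreeE (lcomp g (lfree s))) /=.
apply: eq_bigr => i _; congr (_ *: _); rewrite (bigD1 i) //= big1 => [|j ji].
  by rewrite mxE !eqxx scale1r addr0.
by rewrite mxE eqxx (negPf ji) scale0r.
Qed.

Lemma fg_free M : fin_gen M <-> exists n (g : {linear 'rV[A]_n -> M}), onto g.
Proof.
split=> [[n [e eP]]|[n [g g_onto]]].
  exists n, (lfree e) => x; have [c ->] := eP x; exists (\row_i c i).
  by apply: eq_bigr => i _; rewrite mxE.
exists n, (fun i => g (delta_mx 0 i)) => x; have [c <-] := g_onto x.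
by exists (c 0); rewrite lfreeE.
Qed.

Lemma fg_onto M N (g : {linear M -> N}) : onto g -> fin_gen M -> fin_gen N.
Proof.
move=> g_onto /fg_free[n [f f_onto]]; apply/fg_free; exists n, (lcomp g f) => y.
by have [x <-] := g_onto y; have [z <-] := f_onto x; exists z.
Qed.

Lemma fg_rV n : fin_gen 'rV[A]_n.
Proof. by apply/fg_free; exists n, (lid _) => x; exists x. Qed.

Lemma fg_retract M N : retract M N -> fin_gen N -> fin_gen M.
Proof. by move=> [i [r ir]]; apply: (fg_onto (g := r)) => x; exists (i x). Qed.

Lemma fg_iso M N : linear_iso M N -> fin_gen N -> fin_gen M.
Proof. by move=> /retract_iso/fg_retract. Qed.

Lemma fg_prod M N : fin_gen M -> fin_gen N -> fin_gen (M * N)%type.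
Proof.
move=> /fg_free[m [f f_onto]] /fg_free[n [g g_onto]]; apply/fg_free.
exists (m + n)%N.
exists (lpair (lcomp f (lsubmx : {linear 'rV[A]_(m + n) -> 'rV[A]_m}))
  (lcomp g (rsubmx : {linear 'rV[A]_(m + n) -> 'rV[A]_n}))) => -[x y].
have [[a <-] [b <-]] := (f_onto x, g_onto y).
by exists (row_mx a b); rewrite /= row_mxKl row_mxKr.
Qed.

Lemma fg_dsum F n : (forall i, (i < n)%N -> fin_gen (F i)) -> fin_gen (@dsum A F n).
Proof.
elim: n => [|n IH] Ffg /=; first exact: fg_rV.
by apply: fg_prod; [apply: IH => i /ltnW; apply: Ffg | apply: Ffg].
Qed.

Definition fgp P := projective P /\ fin_gen P.

Lemma fgp_prod P Q : fgp P -> fgp Q -> fgp (P * Q)%type.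
Proof. by move=> [? ?] [? ?]; split; [apply: proj_prod | apply: fg_prod]. Qed.

Lemma fgp_rV n : fgp 'rV[A]_n.
Proof. by split; [apply: proj_free | apply: fg_rV]. Qed.

Lemma fgp_retract M P : retract M P -> fgp P -> fgp M.
Proof.
by move=> MP [? ?]; split; [apply: proj_retract MP _ | apply: fg_retract MP _].
Qed.

Lemma fgp_zero M : zero_mod M -> fgp M.
Proof.
move=> M0; apply: fgp_retract (fgp_rV 0); apply/retract_iso/liso_zero => //.
exact: zero_rV0.
Qed.

Lemma cover_ex M : fin_gen M ->
  exists (K P : lmodType A) (f : {linear K -> P}) (g : {linear P -> M}),
    fgp P /\ short_exact f g.
Proof.
move=> /fg_free[n [g g_onto]]; have [K [f fg]] := ker_ex g_onto.
by exists K, 'rV[A]_n, f, g; split=> //; apply: fgp_rV.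
Qed.

End LinearMaps.

(** * Chain conditions *)

Section ChainConditions.
Context {R : comPzRingType} {A : pzRingType} (phi : {rmorphism R -> A}).
Implicit Type M : lmodType A.
Local Open Scope classical_set_scope.

(** Stability is asked for under [R] only: the sets of homomorphisms to which chain conditions are
    applied later are not A-submodules. *)
Definition rsub M (S : set M) :=
  S 0 /\ forall r x y, S x -> S y -> S (phi r *: x + y).

Lemma rsubD M (S : set M) x y : rsub S -> S x -> S y -> S (x + y).
Proof. by case=> _ Sl Sx Sy; rewrite -[x]scale1r -(rmorph1 phi); apply: Sl. Qed.

Lemma rsubZ M (S : set M) r x : rsub S -> S x -> S (phi r *: x).
Proof. by case=> S0 Sl Sx; rewrite -[_ *: _]addr0; apply: Sl. Qed.

Lemma rsubB M (S : set M) x y : rsub S -> S x -> S y -> S (x - y).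
Proof.
move=> S_sub Sx Sy; apply: rsubD => //; rewrite -scaleN1r -(rmorph1 phi) -rmorphN.
exact: rsubZ.
Qed.

(** The interval from [lo] to [hi] stands for the quotient [hi / lo], so that no quotient module has
    to be formed. *)
Definition between M (lo hi S : set M) := [/\ rsub S, lo `<=` S & S `<=` hi].

Definition chain M (up : bool) (S : nat -> set M) :=
  forall n, if up then S n `<=` S n.+1 else S n.+1 `<=` S n.

(* Ascending ([up = true]) or descending ([up = false]) chain condition for
   the R-submodules between [lo] and [hi]. *)
Definition chain_cond M (up : bool) (lo hi : set M) :=
  forall S, (forall n, between lo hi (S n)) -> chain up S ->
  exists N, forall n, (N <= n)%N -> S n = S N.

Lemma chain_le M up (S : nat -> set M) m n : chain up S -> (m <= n)%N ->
  if up then S m `<=` S n else S n `<=` S m.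
Proof.
move=> S_chain /subnKC <-; elim: (n - m)%N => [|k IH].
  by rewrite addn0; case: up {S_chain} => x.
have := S_chain (m + k)%N; rewrite addnS; case: up IH {S_chain} => IH Sk.
  exact: subset_trans Sk.
exact: subset_trans IH.
Qed.

Lemma chain_cond_sub M up (lo hi lo' hi' : set M) :
  lo' `<=` lo -> hi `<=` hi' -> chain_cond up lo' hi' -> chain_cond up lo hi.
Proof.
move=> lol hih cc S Sb; apply: cc => n; have [? lS Sh] := Sb n.
by split=> //; [apply: subset_trans lS | apply: subset_trans hih].
Qed.

Definition set_add M (S T : set M) : set M :=
  [set z | exists x y, [/\ S x, T y & z = x + y]].

Lemma set_add_rsub M (S T : set M) : rsub S -> rsub T -> rsub (set_add S T).
Proof.
move=> Ss Ts; split; first by exists 0, 0; rewrite addr0; split; [case: Ss|case: Ts|].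
move=> r _ _ [x [y [Sx Ty ->]]] [x' [y' [Sx' Ty' ->]]].
exists (phi r *: x + x'), (phi r *: y + y'); split; [by apply Ss|by apply Ts|].
by rewrite scalerDr addrACA.
Qed.

Lemma modular_eq M (S T mid : set M) : rsub S -> rsub T -> rsub mid ->
  S `<=` T -> S `&` mid = T `&` mid -> set_add S mid = set_add T mid -> S = T.
Proof.
move=> Ss Ts ms ST cap_eq add_eq; apply/seteqP; split=> // x Tx.
have : set_add T mid x by exists x, 0; split=> //; [case: ms | rewrite addr0].
rewrite -add_eq => -[s [m [Ss1 mm xE]]].
have : (T `&` mid) m.
  split=> //; have -> : m = x - s by rewrite xE addrC addKr.
  by apply: rsubB => //; apply: ST.
by rewrite -cap_eq xE => -[Sm _]; apply: rsubD.
Qed.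

(** Intersect the chain with [mid] and add [mid] to it. Once both derived chains are constant, the
    modular law makes the chain itself constant. *)
Lemma chain_cond_trans M up (lo mid hi : set M) : rsub mid -> rsub hi ->
  lo `<=` mid -> mid `<=` hi ->
  chain_cond up lo mid -> chain_cond up mid hi -> chain_cond up lo hi.
Proof.
move=> ms hs lm mh cc1 cc2 S Sb S_chain.
have Ss n : rsub (S n) by case: (Sb n).
have [|n|N1 N1E] := cc1 (fun n => S n `&` mid).
- move=> n; have [_ lS _] := Sb n; split; last exact: subIsetr.
    split=> [|r x y [Sx mx] [Sy my]]; first by split; [case: (Ss n)|case: ms].
    by split; [apply (Ss n) | apply ms].
  by move=> x lx; split; [apply: lS | apply: lm].
- by have := S_chain n; case: up {cc1 cc2 S_chain} => Sn; apply: setSI.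
have [|n|N2 N2E] := cc2 (fun n => set_add (S n) mid).
- move=> n; have [_ _ Sh] := Sb n; split; first exact: set_add_rsub.
    by move=> x mx; exists 0, x; rewrite add0r; split=> //; case: (Ss n).
  by move=> _ [x [y [Sx my ->]]]; apply: rsubD => //; [apply: Sh | apply: mh].
- by have := S_chain n; case: up {cc1 cc2 S_chain N1E} => Sn _ [x [y [Sx my ->]]];
    exists x, y; split=> //; apply: Sn.
exists (maxn N1 N2) => n; rewrite geq_max => /andP[N1n N2n].
have cap_eq : S (maxn N1 N2) `&` mid = S n `&` mid.
  by rewrite (N1E n) // (N1E (maxn _ _)) // leq_maxl.
have add_eq : set_add (S (maxn N1 N2)) mid = set_add (S n) mid.
  by rewrite (N2E n) // (N2E (maxn _ _)) // leq_maxr.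
have /(chain_le S_chain) : (maxn N1 N2 <= n)%N by rewrite geq_max N1n.
by case: up {cc1 cc2 S_chain} => SS; [symmetry|]; apply: (modular_eq (mid := mid)).
Qed.

Lemma chain_cond_refl M up (S : set M) : chain_cond up S S.
Proof.
move=> T Tb _; exists 0%N => n _.
have TE k : T k = S by apply/seteqP; case: (Tb k).
by rewrite !TE.
Qed.

(** Otherwise every candidate could be strictly enlarged, or shrunk, to another one, and choice
    would build a chain that never stops. *)
Lemma chain_cond_extremal M up (lo hi : set M) (Q : set M -> Prop) :
  chain_cond up lo hi -> (exists2 S, between lo hi S & Q S) ->
  exists S, [/\ between lo hi S, Q S &
    forall S', between lo hi S' -> Q S' ->
      (if up then S `<=` S' else S' `<=` S) -> S' = S].
Proof.
move=> cc [S0 S0b S0Q]; apply: contrapT => no_ext.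
pose T := {S : set M | between lo hi S /\ Q S}.
have next (S : T) : exists S' : T,
    (if up then sval S `<=` sval S' else sval S' `<=` sval S) /\
    sval S' <> sval S.
  case: S => S [Sb SQ] /=; apply: contrapT => no_next; apply: no_ext.
  exists S; split=> // S' Sb' SQ' SS'; apply: contrapT => S'S; apply: no_next.
  by exists (exist _ S' (conj Sb' SQ')).
have [f fP] := choice next.
pose S n := iter n f (exist _ S0 (conj S0b S0Q)).
have [||N NE] := cc (fun n => sval (S n)).
- by move=> n; case: (S n) => ? [].
- by move=> n; have [] := fP (S n).
by have [_] := fP (S N); apply; rewrite -[f _]/(S N.+1) NE.
Qed.

Definition set_cyc M (S : set M) e : set M :=
  [set z | exists r y, S y /\ z = phi r *: e + y].

Lemma set_cyc_rsub M (S : set M) e : rsub S -> rsub (set_cyc S e).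
Proof.
move=> Ss; split.
  by exists 0, 0; rewrite rmorph0 scale0r addr0; split=> //; case: Ss.
move=> r _ _ [s [y [Sy ->]]] [s' [y' [Sy' ->]]].
exists (r * s + s'), (phi r *: y + y'); split; first by apply Ss.
by rewrite rmorphD rmorphM scalerDl scalerDr scalerA addrACA.
Qed.

Lemma set_cyc_sub M (S : set M) e : S `<=` set_cyc S e.
Proof. by move=> y Sy; exists 0, y; rewrite rmorph0 scale0r add0r. Qed.

Lemma set_cyc_gen M (S : set M) e : rsub S -> set_cyc S e e.
Proof.
by move=> [S0 _]; exists 1, 0; rewrite rmorph1 scale1r addr0.
Qed.

(* An interval of submodules killed by a maximal ideal [m] of [R] is an
   interval of subspaces, where the two chain conditions agree. *)
Lemma acc_of_dcc M (m : set R) (lo hi : set M) : rsub lo -> rsub hi ->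
  (forall r, ~ m r -> exists s, m (1 - s * r)) ->
  (forall r x, m r -> hi x -> lo (phi r *: x)) ->
  chain_cond false lo hi -> chain_cond true lo hi.
Proof.
move=> los his m_max m_kill dcc S Sb S_chain.
have Ss n : rsub (S n) by case: (Sb n).
have Shi n : S n `<=` hi by case: (Sb n).
have loS n : lo `<=` S n by case: (Sb n).
(* [x i] witnesses a strict step from [S i] to [S i.+1]; the default 0 marks a step where the chain
   does not grow. *)
have /choice[x xP] i : exists x,
    S i.+1 x /\ (x = 0 /\ S i.+1 `<=` S i \/ ~ S i x).
  have [SS|/existsNP[x /not_implyP[Sx nSx]]] := pselect (S i.+1 `<=` S i).
    by exists 0; split; [case: (Ss i.+1) | left].
  by exists x; split=> //; right.
(* [sp i l] is [lo] plus the R-span of [x i, ..., x (i + l - 1)]. Its union [D i] over [l] decreases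
   with [i], so the descending condition applies. *)
pose sp i := fix sp l := if l is k.+1 then set_cyc (sp k) (x (i + k)%N) else lo.
have sp_rsub i l : rsub (sp i l) by elim: l => //= l; apply: set_cyc_rsub.
have sp_lo i l : lo `<=` sp i l.
  by elim: l => //= l IH; apply: subset_trans IH _; apply: set_cyc_sub.
have sp_le i k l : (k <= l)%N -> sp i k `<=` sp i l.
  move=> /subnKC <-; elim: (l - k)%N => [|j IH]; first by rewrite addn0.
  by rewrite addnS; apply: subset_trans IH _; apply: set_cyc_sub.
have sp_S i l : sp i l `<=` S (i + l)%N.
  elim: l => [|l IH]; first by rewrite addn0 /=; exact: (loS i).
  move=> _ [r [y [yl ->]]]; rewrite addnS.
  apply: rsubD => //; first by apply: rsubZ => //; apply (xP _).1.
  by apply: S_chain; apply: IH.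
pose D i : set M := [set z | exists l, sp i l z].
have [i|i z [l]|i0 i0E] := dcc D.
- split=> [|z zlo|z [l /sp_S/Shi] //]; last by exists 0%N.
  split=> [|r u v [k uk] [l vl]]; first by exists 0%N; case: los.
  exists (maxn k l); apply sp_rsub; [apply: (sp_le _ k) uk|apply: (sp_le _ l) vl].
    exact: leq_maxl.
  exact: leq_maxr.
- suff sub : sp i.+1 l `<=` sp i l.+1 by move=> /sub zl; exists l.+1.
  elim: l {z} => [|l IH] z; first exact: (sp_lo i 1%N).
  by move=> [r [y [/IH yl ->]]]; exists r, y; rewrite addnS.
(* Past [i0], [x n] lies in the span of the later witnesses. Their terms are removed from the last
   one down: if the coefficient [c] is in [m], the term falls into [lo]; otherwise [c] is invertible
   modulo [m], and [x j], unless it is 0, would already lie in [S j]. *)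
have stop n : (i0 <= n)%N -> S n.+1 `<=` S n.
  move=> i0n; apply: contrapT => nSS; have [Sx [[_ //]|nSx]] := xP n; apply: nSx.
  have : D n.+1 (x n).
    rewrite i0E ?(leq_trans i0n) // -(i0E n) //; exists 1%N => /=.
    by rewrite addn0; apply: set_cyc_gen.
  case=> l; elim: l (x n) Sx => [|l IH] y Sy; first exact: (loS n).
  move=> [c [z [zl yE]]]; have [mc|/m_max[s ms]] := pselect (m c).
    apply: IH => //; rewrite yE; apply: rsubD => //; apply: sp_lo.
    by apply: m_kill => //; apply: Shi (xP _).1.
  apply: IH => //; suff -> : y = z by [].
  set j := (n.+1 + l)%N in yE; have [Sxj [[xj0 _]|nSxj]] := xP j.
    by rewrite yE xj0 scaler0 add0r.
  case: nSxj.
  have -> : x j = phi (1 - s * c) *: x j + phi s *: (y - z).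
    rewrite yE addrK scalerA -rmorphM -scalerDl -rmorphD addrNK.
    by rewrite rmorph1 scale1r.
  apply: rsubD => //; first by apply: loS; apply: m_kill => //; apply: Shi Sxj.
  apply: rsubZ => //; apply: rsubB => //; last exact: sp_S zl.
  by apply: (chain_le S_chain (leq_addr l n.+1)).
exists i0 => n /subnKC <-; elim: (n - i0)%N => [|k IH]; first by rewrite addn0.
rewrite -[RHS]IH addnS; apply/seteqP; split; last exact: S_chain.
exact: stop (leq_addr _ _).
Qed.

End ChainConditions.

Lemma artinian_dcc (R : comPzRingType) : artinian R ->
  chain_cond (idfun : {rmorphism R -> R}) false [set 0 : R^o]%classic setT.
Proof.
move=> artR S Sb S_chain.
have [n|n x /asboolP Sx|N NE] := artR (fun n => [pred x | `[< S n x >]]).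
- have [[S0 Sl] _ _] := Sb n; split; first exact/asboolP.
  by move=> a x y /asboolP Sx /asboolP Sy; apply/asboolP/Sl.
- exact/asboolP/S_chain.
exists N => n /NE SE; apply/seteqP; split=> x /asboolP Sx; apply/asboolP;
  by have := SE x; rewrite !unfold_in /= Sx.
Qed.

(* Take [I] minimal with R/I noetherian.  If [I <> 0], an ideal [J] minimal
   with [I J <> 0] is cyclic, generated by [x], and [Ann (x I)] is maximal; so
   [R / (I :&: Ann x)] is noetherian as well, and minimality forces [x I = 0]. *)
Lemma artinian_acc (R : comPzRingType) : artinian R ->
  chain_cond (idfun : {rmorphism R -> R}) true [set 0 : R^o]%classic setT.
Proof.
move=> /artinian_dcc dcc; set id_ := (idfun : {rmorphism R -> R}) in dcc *.
have subT (S : set R^o) : rsub id_ S -> between id_ [set 0]%classic setT S.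
  by move=> Ss; split=> // x ->; case: Ss.
have Ts : rsub id_ (setT : set R^o) by [].
have [|I [[Is _ _] I_good I_min]] :=
    @chain_cond_extremal _ _ id_ R^o false [set 0]%classic setT
      (fun I => chain_cond id_ true I setT) dcc.
  by exists setT; [apply: subT | apply: chain_cond_refl].
suff I0 : I = [set 0]%classic by rewrite -I0.
apply/seteqP; split=> [i0 Ii0|_ ->]; last by case: Is.
apply: contrapT => i0_neq0.
have [|J [[Js _ _] [i1 [x [Ii1 Jx ix_neq0]]] J_min]] :=
    @chain_cond_extremal _ _ id_ R^o false [set 0]%classic setT
      (fun J => exists i j : R^o, [/\ I i, J j & (i : R) * j <> 0]) dcc.
  by exists setT; [apply: subT | exists i0, 1; split=> //; rewrite mulr1].
pose m : set R := [set r | forall i, I i -> r * ((x : R) * i) = 0]%classic.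
pose lo : set R^o := [set y | I y /\ (x : R) * y = 0]%classic.
have los : rsub id_ lo.
  split=> [|r y z [Iy xy] [Iz xz]]; first by split; [case: Is | rewrite mulr0].
  split; first by apply Is.
  by rewrite mulrDr xz addr0 /= [_ *: _]/(_ * _) mulrCA xy mulr0.
have loI : (lo `<=` I)%classic by move=> y [].
(* If [r] is not in [m], then [r x] still does not kill [I], so minimality makes [r x] generate [J].
   From [x = s r x] it follows that [1 - s r] kills [x I]. *)
have m_max r : ~ m r -> exists s, m (1 - s * r).
  move=> /existsNP[i /not_implyP[Ii rxi]].
  pose J' : set R^o := [set y | exists s, y = s * (r * (x : R))]%classic.
  have J's : rsub id_ J'.
    split=> [|c _ _ [s ->] [s' ->]]; first by exists 0; rewrite mul0r.
    by exists (c * s + s'); rewrite mulrDl -mulrA.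
  have J'J : J' = J.
    apply: J_min; first exact: subT.
    - exists i, (r * (x : R)); split=> //; first by exists 1; rewrite mul1r.
      by rewrite mulrC -mulrA.
    - by move=> _ [s ->]; rewrite mulrA; apply: (rsubZ (s * r) Js).
  have [s xE] : J' x by rewrite J'J.
  exists s => k Ik; rewrite mulrA mulrBl mul1r -mulrA -xE.
  by rewrite subrr mul0r.
suff lo_good : chain_cond id_ true lo setT.
  have loE : lo = I by apply: I_min => //; apply: subT.
  have [_ xi] : lo i1 by rewrite loE.
  by apply: ix_neq0; rewrite mulrC.
apply: chain_cond_trans I_good => //.
apply: (acc_of_dcc los Is m_max).
  move=> r y mr Iy; split; first exact: rsubZ.
  by rewrite [_ *: _]/(_ * _) mulrCA mr.
by apply: chain_cond_sub dcc => // _ ->; case: los.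
Qed.

(** * Finitely generated modules over an artin algebra *)

Section ArtinAlgebra.
Context {R : comPzRingType} {A : pzRingType} (phi : {rmorphism R -> A}).
Hypothesis phi_artin : artin_algebra phi.
Implicit Types K M N P : lmodType A.

(** The quotient of [lo + R e] by [lo] is cyclic over [R]: a chain is determined by the ideals of
    those [r] for which [phi r *: e] lies in [S n]. *)
Lemma chain_cond_cyc M up (lo : set M) e : rsub phi lo ->
  chain_cond phi up lo (set_cyc phi lo e).
Proof.
move=> los S Sb S_chain.
have [artR _ _] := phi_artin.
have cc : chain_cond (idfun : {rmorphism R -> R}) up [set 0 : R^o]%classic setT.
  by case: up {S_chain}; [apply: artinian_acc | apply: artinian_dcc].
have [n|n|k kE] := cc (fun n => [set r : R^o | S n (phi r *: e)])%classic.
- have [Ss _ _] := Sb n; split=> //.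
    split=> [|a x y Sx Sy] /=; first by rewrite rmorph0 scale0r; case: Ss.
    by rewrite rmorphD rmorphM scalerDl -scalerA; apply Ss.
  by move=> _ -> /=; rewrite rmorph0 scale0r; case: Ss.
- by have := S_chain n; case: up {cc S_chain} => SS x; apply: SS.
have SE n : S n = [set z | exists r y, [/\ S n (phi r *: e), lo y
    & z = phi r *: e + y]]%classic.
  have [Ss loS Shi] := Sb n; apply/seteqP; split=> z.
    move=> Sz; have [r [y [loy zE]]] := Shi _ Sz; exists r, y; split=> //.
    have -> : phi r *: e = z - y by rewrite zE addrK.
    by apply: (rsubB Ss Sz); apply: loS.
  by move=> [r [y [Sr loy ->]]]; apply: (rsubD Ss) => //; apply: loS.
exists k => n /kE nkE; rewrite SE [RHS]SE.
have rE r : S n (phi r *: e) = S k (phi r *: e).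
  by have := congr1 (fun T : set R^o => T r) nkE.
apply/seteqP; split=> z [r [y [Sr loy ->]]]; exists r, y; split=> //.
  by rewrite -rE.
by rewrite rE.
Qed.

Definition rspan M (s : seq M) : set M := foldr (fun e S => set_cyc phi S e) [set 0]%classic s.

Lemma rspan_rsub M (s : seq M) : rsub phi (rspan s).
Proof.
elim: s => [|e s IH]; last exact: set_cyc_rsub.
by split=> // r _ _ -> ->; rewrite /= scaler0 addr0.
Qed.

Lemma rspan_mem M (s : seq M) x : x \in s -> rspan s x.
Proof.
elim: s => // e s IH; rewrite inE => /predU1P[->|/IH].
  exact/set_cyc_gen/rspan_rsub.
exact: set_cyc_sub.
Qed.

Lemma rspan_ex M : fin_gen M -> exists s : seq M, rspan s = setT.
Proof.
move=> [n [e eP]]; have [_ _ [m [a aP]]] := phi_artin.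
pose s := [seq a j *: e i | i <- enum 'I_n, j <- enum 'I_m].
exists s; have Ss := rspan_rsub s.
apply/seteqP; split=> // x _; have [c ->] := eP x.
apply: (big_ind (rspan s)) => [|u v|i _]; [by case: Ss|exact: (rsubD Ss)|].
have [d ->] := aP (c i); rewrite scaler_suml.
apply: (big_ind (rspan s)) => [|u v|j _]; [by case: Ss|exact: (rsubD Ss)|].
rewrite -scalerA; apply: (rsubZ _ Ss); apply/rspan_mem/allpairs_f; exact: mem_enum.
Qed.

(** Such a module is finitely generated over [R] too, hence filtered by finitely many cyclic
    R-modules. *)
Lemma chain_cond_fg M up : fin_gen M -> chain_cond phi up [set 0 : M]%classic setT.
Proof.
move=> /rspan_ex[s <-]; elim: s => [|e s IH]; first exact: chain_cond_refl.
apply: (chain_cond_trans (rspan_rsub s) (rspan_rsub (e :: s))) => //.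
- by move=> _ ->; case: (rspan_rsub s).
- exact: set_cyc_sub.
exact/chain_cond_cyc/rspan_rsub.
Qed.

Lemma submod_between M (S : set M) : submod S -> between phi [set 0]%classic setT S.
Proof.
move=> [S0 Sl]; split=> //; last by move=> _ ->.
by split=> // r x y; apply: Sl.
Qed.

(** Among the images in [M] of finitely generated free modules mapping to [K], take a maximal one;
    adjoining any [x] of [K] as a generator cannot enlarge it. *)
Lemma fg_sub K M (i : {linear K -> M}) : injective i -> fin_gen M -> fin_gen K.
Proof.
move=> i_inj M_fg; pose Q (S : set M) := exists n (g : {linear 'rV[A]_n -> K}),
  S = (fun y => exists x, i (g x) = y).
have [|S [_ [n [g SE]] S_max]] :=
    chain_cond_extremal (Q := Q) (chain_cond_fg (up := true) M_fg).
  exists (fun y => exists x, i (lzero 'rV[A]_0 K x) = y).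
    exact/submod_between/(range_submod (lcomp i (lzero 'rV[A]_0 K))).
  by exists 0%N, (lzero _ _).
apply/fg_free; exists n, g => x.
have [m [h [z hz]]] : exists m (h : {linear 'rV[A]_m -> K}), exists z, h z = x.
  by exists 1%N, (lfree (fun=> x)), (delta_mx 0 0); rewrite /= big_ord1 mxE scale1r.
pose gh := lcopair (lcomp g (lsubmx : {linear 'rV[A]_(n + m) -> 'rV[A]_n}))
  (lcomp h (rsubmx : {linear 'rV[A]_(n + m) -> 'rV[A]_m})).
pose gh' := lcomp gh (lpair (lid _) (lid 'rV[A]_(n + m))).
have ghE u v : gh' (row_mx u v) = g u + h v by rewrite /= row_mxKl row_mxKr.
have S'S : (fun y => exists x, i (gh' x) = y) = S.
  apply: S_max; first exact/submod_between/(range_submod (lcomp i gh')).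
    by exists (n + m)%N, gh'.
  rewrite SE => _ [u <-]; exists (row_mx u 0); by rewrite ghE linear0 addr0.
have : S (i x) by rewrite -S'S; exists (row_mx 0 z); rewrite ghE linear0 add0r hz.
by rewrite SE => -[u /i_inj]; exists u.
Qed.

(** For linear [g] this says that [M] is the direct sum of the kernel and the image of [g]. *)
Definition fit M (g : M -> M) :=
  (forall x, g (g x) = 0 -> g x = 0) /\ (forall x, exists y, g x = g (g y)).

(** Kernels of powers ascend and images descend, so both stabilize. All large exponents are covered,
    which lets several endomorphisms share one. *)
Lemma fitting M (f : {linear M -> M}) : fin_gen M ->
  exists n0, forall n, (n0 <= n)%N -> fit (liter n f).
Proof.
move=> M_fg.
have [n|n x /= -> /=|k kE] := chain_cond_fg (up := true) M_fg
    (S := fun n x => liter n f x = 0).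
- exact/submod_between/ker_submod.
- exact: linear0.
have [n|n _ /= [x <-]|m mE] := chain_cond_fg (up := false) M_fg
    (S := fun n y => exists x, liter n f x = y).
- exact/submod_between/range_submod.
- by exists (f x); rewrite -iterSr.
exists (maxn k m) => n; rewrite geq_max => /andP[kn mn]; split=> x /=.
  rewrite -iterD; have nn : (n <= n + n)%N by exact: leq_addr.
  have := congr1 (fun S : set M => S x) (kE _ kn).
  have := congr1 (fun S : set M => S x) (kE _ (leq_trans kn nn)).
  by move=> /= -> ->.
have nn : (n <= n + n)%N by exact: leq_addr.
have [y yE] : exists y, liter (n + n) f y = iter n f x.
  have := congr1 (fun S : set M => S (iter n f x)) (mE _ mn).
  have := congr1 (fun S : set M => S (iter n f x)) (mE _ (leq_trans mn nn)).
  by move=> /= -> <-; exists x.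
by exists y; rewrite -iterD.
Qed.

(* Fitting decomposition: the image of [g] is a direct summand with
   complement [ker g], on which [g] is invertible (with inverse [s]). *)
Lemma fit_split M (g : {linear M -> M}) : fit g ->
  exists N (i : {linear N -> M}) (r s : {linear M -> N}),
  [/\ cancel i r, forall x, s (g (i x)) = x,
      forall y, (exists x, i x = y) <-> (exists z, g z = y)
    & forall x, r x = 0 <-> g x = 0].
Proof.
move=> [fit_ker fit_im].
have [N [i [i_inj iE]]] := submod_ex (range_submod g).
have /(linear_lift i_inj)[g' g'E] x : exists y, i y = g x by apply/iE; exists x.
pose h := lcomp g' i.
have h_inj : injective h.
  apply: inj0 => x /= /(congr1 i); rewrite g'E linear0.
  have [y yE] : exists y, g y = i x by apply/iE; exists x.
  by rewrite -yE => /fit_ker gy; apply: i_inj; rewrite -yE gy linear0.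
have h_onto : onto h.
  move=> x; have [y yE] : exists y, g y = i x by apply/iE; exists x.
  have [z zE] := fit_im y; have [w wE] : exists w, i w = g z by apply/iE; exists z.
  by exists w; apply: i_inj; rewrite /= g'E wE -zE.
have /(linear_lift h_inj)[d dE] x : exists y, h y = lid N x by apply: h_onto.
have dh x : d (h x) = x by apply: h_inj; rewrite dE.
pose r := lcomp d g'.
exists N, i, r, (lcomp d r).
have ir : cancel i r by move=> x; apply: dh.
split=> // [x|y|x]; last 2 first.
- by split=> /iE.
- split=> [/= dx|gx] /=.
    have : h (d (g' x)) = 0 by rewrite dx linear0.
    by rewrite dE /= => gx; rewrite -g'E gx linear0.
  have -> : g' x = 0 by apply: i_inj; rewrite g'E gx linear0.
  by rewrite linear0.
by rewrite /= -g'E -[d (g' (i _))]/(r (i _)) ir dh.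
Qed.

Lemma inj_onto M (f : {linear M -> M}) : fin_gen M -> injective f -> onto f.
Proof.
move=> /(fitting f)[n /(_ n.+1 (leqnSn n))[_ im]] f_inj y.
have [x xE] := im y; exists (iter n f x).
have iter_inj k : injective (iter k f).
  by elim: k => //= k IH u v /f_inj/IH.
by apply: (iter_inj n.+1); rewrite /= in xE *; rewrite xE -iterSr -iterS.
Qed.

(** Take a summand [N] of a free cover, minimal among those still mapping onto [M]. If [h] composes
    to an epimorphism, some [v] factoring through [h] preserves the map to [M]. The image of a high
    power of [v] is again such a summand, so by minimality this power, and hence [h], is onto. *)
Lemma proj_cover_ex M : fin_gen M ->
  exists (P : lmodType A) (g : {linear P -> M}), fgp P /\ projective_cover g.
Proof.
move=> /fg_free[n [g g_onto]]; set F := 'rV[A]_n in g g_onto.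
pose Q (S : set F) := exists N (i : {linear N -> F}) (r : {linear F -> N}),
  [/\ cancel i r, onto (lcomp g i) & S = (fun y => exists x, i x = y)].
have [|S [_ [N [i [r [ir gi_onto SE]]]] S_min]] :=
    chain_cond_extremal (Q := Q) (chain_cond_fg (up := false) (fg_rV n)).
  exists (fun y => exists x, lid F x = y); first exact/submod_between/range_submod.
  by exists F, (lid F), (lid F).
have N_fgp : fgp N by apply: fgp_retract (fgp_rV n); exists i, r.
exists N, (lcomp g i); split=> //; split; [by case: N_fgp|exact/ontoP|].
move=> X h /ontoP gih_onto; apply/ontoP.
have [u uE] := proj_lift (g := lcomp (lcomp g i) h) (lcomp g i) N_fgp.1 gih_onto.
pose v := lcomp h u.
have giv k x : g (i (iter k v x)) = g (i x).
  by elim: k => //= k IH; rewrite -[LHS]/(lcomp (lcomp g i) h (u _)) uE /= IH.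
have [k /(_ k.+1 (leqnSn k)) v_fit] := fitting v N_fgp.2.
have [N' [i' [r' [s [ir' _ i'E _]]]]] := fit_split v_fit.
have S'S : (fun y => exists x, lcomp i i' x = y) = S.
  apply: S_min; first exact/submod_between/range_submod.
    exists N', (lcomp i i'), (lcomp r' r); split=> //.
      by move=> x /=; rewrite ir ir'.
    move=> y; have [x <-] := gi_onto y.
    have [x' xE] : exists x', i' x' = liter k.+1 v x by apply/i'E; exists x.
    by exists x'; rewrite /= xE giv.
  by rewrite SE => _ [x <-]; exists (i' x).
move=> y; have : S (i y) by rewrite SE; exists y.
rewrite -S'S => -[x /= /(can_inj ir) <-].
have [z <-] : exists z, liter k.+1 v z = i' x by apply/i'E; exists x.
by exists (u (iter k v z)).
Qed.

Fact lscale_subproof M r : linear (fun x : M => phi r *: x).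
Proof.
move=> a x y; rewrite scalerDr !scalerA; congr (_ *: _ + _).
by have [_ ->] := phi_artin.
Qed.
Definition lscale M r : {linear M -> M} := mklin (lscale_subproof (M := M) r).

Fixpoint tup M (x : nat -> M) n : dsum (fun=> M) n :=
  if n is m.+1 then (tup x m, x m) else 0.

Lemma tup_lin M (x y : nat -> M) a n :
  tup (fun i => a *: x i + y i) n = a *: tup x n + tup y n.
Proof. by elim: n => [|n IH] /=; [rewrite scaler0 addr0 | rewrite IH]. Qed.

Lemma tup_inj M (x y : nat -> M) n : tup x n = tup y n ->
  forall i, (i < n)%N -> x i = y i.
Proof.
elim: n => // n IH [/IH xy xyn] i; rewrite ltnS leq_eqVlt => /predU1P[->//|].
exact: xy.
Qed.

(** Evaluation at generators of [M] embeds the homomorphisms into a power of [N], where the classes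
    [Q k] become an ascending chain of R-submodules. *)
Lemma hom_chain M N (Q : nat -> {linear M -> N} -> Prop) :
  fin_gen M -> fin_gen N ->
  (forall k (f g : {linear M -> N}), f =1 g -> Q k f -> Q k g) ->
  (forall k, Q k (lzero M N)) ->
  (forall k r f g, Q k f -> Q k g -> Q k (ladd (lcomp (lscale N r) f) g)) ->
  (forall k f, Q k f -> Q k.+1 f) ->
  exists n0, forall k f, Q k f -> Q n0 f.
Proof.
move=> [n [e eP]] N_fg Q_ext Q0 Ql Qup.
(* The generators, continued by 0 beyond [n]. *)
pose e' i := if insub i is Some j then e j else 0.
have e'E (j : 'I_n) : e' j = e j by rewrite /e' valK.
pose ev (f : {linear M -> N}) := tup (fun i => f (e' i)) n.
have ev_inj (f g : {linear M -> N}) : ev f = ev g -> f =1 g.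
  move=> /tup_inj fg x; have [c ->] := eP x; rewrite !linear_sum.
  by apply: eq_bigr => j _; rewrite !linearZ_LR -e'E fg.
have D_fg : fin_gen (@dsum A (fun=> N) n) by apply: fg_dsum.
have [k|k _ [f [Qf ->]]|n0 n0E] := chain_cond_fg (up := true) D_fg
    (S := fun k z => exists f, Q k f /\ z = ev f).
- split=> //.
    split=> [|r _ _ [f [Qf ->]] [g [Qg ->]]].
      exists (lzero M N); split=> //; rewrite /ev /=.
      by elim: (n) => //= m <-.
    by exists (ladd (lcomp (lscale N r) f) g); split; [apply: Ql|rewrite -tup_lin].
  move=> _ ->; exists (lzero M N); split=> //; rewrite /ev /=.
  by elim: (n) => //= m <-.
- by exists f; split=> //; apply: Qup.
exists n0 => k f Qf.
have QK j : Q k f -> Q (j + k)%N f by move=> ?; elim: j => //= j IH; apply: Qup.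
have : exists g, Q (n0 + k)%N g /\ ev f = ev g by exists f; split=> //; apply: QK.
have := congr1 (fun S : set _ => S (ev f)) (n0E _ (leq_addr k n0)).
by move=> /= -> [g [Qg /esym/ev_inj/Q_ext]]; apply.
Qed.

End ArtinAlgebra.

(** * Direct sums and indecomposable modules *)

Section DirectSums.
Context {A : pzRingType}.
Implicit Types M N : lmodType A.
Implicit Types F G U : nat -> lmodType A.

Lemma dsum_iso F G n : (forall i, (i < n)%N -> linear_iso (F i) (G i)) ->
  linear_iso (dsum F n) (dsum G n).
Proof.
elim: n => [|n IH] FG /=; first exact: liso_refl.
by apply: liso_prod; [apply: IH => i /ltnW; apply: FG | apply: FG].
Qed.

Lemma dsum_cat F G m n : linear_iso (dsum F m * dsum G n)%type
  (dsum (fun i => if (i < m)%N then F i else G (i - m)%N) (m + n)).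
Proof.
elim: n => [|n IH]; rewrite ?addn0 ?addnS /=.
  apply: liso_trans (liso_prodr0 _ (@zero_rV0 A)) _.
  by apply: dsum_iso => i im; rewrite im; apply: liso_refl.
apply: liso_trans (liso_prodA _ _ _) _; apply: liso_prod IH _.
by rewrite ltnNge leq_addr /= addKn; apply: liso_refl.
Qed.

Lemma dsum_const_add M m n :
  linear_iso (dsum (fun=> M) m * dsum (fun=> M) n)%type (dsum (fun=> M) (m + n)).
Proof.
apply: liso_trans (dsum_cat _ _ _ _) _; apply: dsum_iso => i _.
by case: ifP => _; apply: liso_refl.
Qed.

Lemma dsum_prod F G n :
  linear_iso (dsum F n * dsum G n)%type (dsum (fun i => F i * G i)%type n).
Proof.
elim: n => [|n IH] /=; first exact: liso_prodr0 (@zero_rV0 A).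
by apply: liso_trans (liso_prodACA _ _ _ _) _; apply: liso_prod IH (liso_refl _).
Qed.

Lemma dsum_retract F n i : (i < n)%N -> retract (F i) (dsum F n).
Proof.
elim: n => // n IH; rewrite ltnS leq_eqVlt => /predU1P[->|/IH Fi] /=.
  exact: retractr.
exact: retract_trans Fi (retractl _ _).
Qed.

Lemma dsum_retract2 F G n : (forall i, (i < n)%N -> retract (F i) (G i)) ->
  retract (dsum F n) (dsum G n).
Proof.
elim: n => [|n IH] FG /=; first exact: retract_refl.
by apply: retract_prod; [apply: IH => i /ltnW; apply: FG | apply: FG].
Qed.

Definition msum U (v : nat -> nat) q := dsum (fun i => dsum (fun=> U i) (v i)) q.

Lemma msum_add U v w q :
  linear_iso (msum U v q * msum U w q)%type (msum U (fun i => v i + w i)%N q).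
Proof.
apply: liso_trans (dsum_prod _ _ _) _; apply: dsum_iso => i _.
exact: dsum_const_add.
Qed.

Lemma msum_ext U v w q : (forall i, (i < q)%N -> v i = w i) ->
  linear_iso (msum U v q) (msum U w q).
Proof. by move=> vw; apply: dsum_iso => i /vw ->; apply: liso_refl. Qed.

Lemma msum0 U v q : (forall i, (i < q)%N -> v i = 0%N) -> zero_mod (msum U v q).
Proof.
elim: q => [|q IH] v0; first exact: zero_rV0.
have {}IH : zero_mod (msum U v q) by apply: IH => i /ltnW; apply: v0.
move=> [x y]; congr pair; first exact: IH.
by move: y; rewrite v0 //; apply: zero_rV0.
Qed.

Lemma msum1 U q j : (j < q)%N -> linear_iso (U j) (msum U (fun i => i == j) q).
Proof.
elim: q => // q IH; rewrite ltnS leq_eqVlt => /predU1P[->|jq].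
  rewrite /msum /= eqxx /=; apply: liso_sym.
  apply: liso_trans (liso_prodC _ _) _.
  apply: liso_trans (liso_prodr0 _ _) _.
    by apply: msum0 => i iq; rewrite ltn_eqF.
  by apply: liso_trans (liso_prodC _ _) _; apply/liso_prodr0/zero_rV0.
apply: liso_trans (IH jq) _; apply/liso_sym/liso_prodr0.
by rewrite gtn_eqF //=; apply: zero_rV0.
Qed.

Lemma msum_of_dsum U q F n :
  (forall i, (i < n)%N -> exists2 j, (j < q)%N & linear_iso (F i) (U j)) ->
  exists v, linear_iso (dsum F n) (msum U v q).
Proof.
elim: n => [|n IH] FU /=.
  by exists (fun=> 0%N); apply: liso_zero; [apply: zero_rV0 | apply: msum0].
have [|v vE] := IH; first by move=> i /ltnW; apply: FU.
have [//|j jq jE] := FU n; exists (fun i => v i + (i == j))%N.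
apply: liso_trans (liso_prod vE (liso_trans jE (msum1 U jq))) _.
exact: msum_add.
Qed.

Lemma fg_msum U v q : (forall i, (i < q)%N -> fin_gen (U i)) -> fin_gen (msum U v q).
Proof. by move=> U_fg; apply: fg_dsum => i iq; apply: fg_dsum => _ _; apply: U_fg. Qed.

End DirectSums.

(** * Decompositions into indecomposable modules *)

Section KrullSchmidt.
Context {R : comPzRingType} {A : pzRingType} (phi : {rmorphism R -> A}).
Hypothesis phi_artin : artin_algebra phi.
Implicit Types M N C X Y : lmodType A.

Definition indec C := ~ zero_mod C /\
  forall X Y, linear_iso C (X * Y)%type -> zero_mod X \/ zero_mod Y.

(** Otherwise take a minimal summand without a decomposition. It is neither zero nor indecomposable,
    so it splits into two smaller summands; these decompose, a contradiction. *)
Lemma decomposition M : fin_gen M -> exists n (F : nat -> lmodType A),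
  (forall i, (i < n)%N -> indec (F i) /\ fin_gen (F i)) /\ linear_iso M (dsum F n).
Proof.
pose dec M := exists n (F : nat -> lmodType A),
  (forall i, (i < n)%N -> indec (F i) /\ fin_gen (F i)) /\ linear_iso M (dsum F n).
move=> M_fg; apply: contrapT => M_ndec.
pose Q (S : set M) := exists N (i : {linear N -> M}) (r : {linear M -> N}),
  [/\ cancel i r, ~ dec N & S = (fun y => exists x, i x = y)].
have [|S [_ [N [i [r [ir N_ndec SE]]]] S_min]] :=
    chain_cond_extremal (Q := Q) (chain_cond_fg (up := false) phi_artin M_fg).
  exists (fun y => exists x, lid M x = y); first exact/submod_between/range_submod.
  by exists M, (lid M), (lid M).
have N_fg : fin_gen N by apply: fg_retract M_fg; exists i, r.
have summand X Y : linear_iso N (X * Y)%type -> ~ zero_mod Y -> dec X.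
  move=> /liso_ex[f [g [fK gK]]] Y0; apply: contrapT => X_ndec; apply: Y0 => y.
  have S'S : (fun y => exists x, lcomp i (lcomp g (linl X Y)) x = y) = S.
    apply: S_min; first exact/submod_between/range_submod.
      exists X, (lcomp i (lcomp g (linl X Y))), (lcomp (lfst X Y) (lcomp f r)).
      by split=> // x /=; rewrite ir gK.
    by rewrite SE => _ [x <-]; exists (g (x, 0)).
  have : S (i (g (0, y))) by rewrite SE; exists (g (0, y)).
  by rewrite -S'S => -[x /= /(can_inj ir)/(can_inj gK)[]].
have N0 : ~ zero_mod N.
  move=> N0; apply: N_ndec; exists 0%N, (fun=> N); split=> //.
  by apply: liso_zero => //; apply: zero_rV0.
have [|X_or_Y] := pselect (indec N).
  move=> N_indec; apply: N_ndec; exists 1%N, (fun=> N); split=> // /=.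
  apply: liso_sym; apply: liso_trans (liso_prodC _ _) _.
  exact/liso_prodr0/zero_rV0.
have [X [Y [NXY [X0 Y0]]]] :
    exists X Y, linear_iso N (X * Y)%type /\ (~ zero_mod X /\ ~ zero_mod Y).
  apply: contrapT => no; apply: X_or_Y; split=> // X Y NXY.
  have [|X0] := pselect (zero_mod X); [by left | right].
  by apply: contrapT => Y0; apply: no; exists X, Y.
have [m [F [F_ind XE]]] := summand X Y NXY Y0.
have [n [G [G_ind YE]]] := summand Y X (liso_trans NXY (liso_prodC _ _)) X0.
apply: N_ndec; exists (m + n)%N, (fun i => if (i < m)%N then F i else G (i - m)%N).
split=> [k kmn|]; last first.
  exact: liso_trans NXY (liso_trans (liso_prod XE YE) (dsum_cat _ _ _ _)).
case: ltnP => km; first exact: F_ind.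
by apply: G_ind; rewrite ltn_subLR.
Qed.

(** Locality of the endomorphism ring. By Fitting's lemma a power of [u] has zero kernel or zero
    image: either [u] is injective, or [u] is nilpotent and [v] is injective. Injective
    endomorphisms are onto by [inj_onto]. *)
Lemma indec_local C (u v : {linear C -> C}) : indec C -> fin_gen C ->
  (forall x, u x + v x = x) ->
  (exists w : {linear C -> C}, forall x, u (w x) = x) \/
  (exists w : {linear C -> C}, forall x, v (w x) = x).
Proof.
move=> [C0 C_ind] C_fg uv.
have surj_inv (f : {linear C -> C}) : injective f ->
    exists w : {linear C -> C}, forall x, f (w x) = x.
  move=> f_inj; have f_onto := inj_onto phi_artin C_fg f_inj.
  exact: (linear_lift (h := lid C) f_inj).
have [n /(_ n.+1 (leqnSn n)) u_fit] := fitting phi_artin u C_fg.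
have [N [i [r [s [ir _ iE rE]]]]] := fit_split u_fit.
have r_onto : onto r by move=> x; exists (i x).
have [K [k kr]] := ker_ex r_onto; have [k_inj rk k_ker _] := (short_exactP _ _).1 kr.
have [] := C_ind K N (split_iso kr ir) => [K0|N0]; [left|right]; apply: surj_inv.
  apply: inj0 => x ux; have [y <-] : exists y, k y = x.
    by apply/k_ker/rE; rewrite /= -iterS iterSr ux; apply: (linear0 (liter n u)).
  by rewrite (K0 y) linear0.
apply: inj0 => x vx; have ux : u x = x by rewrite -[RHS]uv vx addr0.
have u_iter m : iter m u x = x by elim: m => //= m ->.
by rewrite -(u_iter n.+1); apply/rE; apply: N0.
Qed.

Lemma indec_retract C F n : indec C -> fin_gen C -> retract C (dsum F n) ->
  exists2 i, (i < n)%N & retract C (F i).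
Proof.
move=> C_ind C_fg; elim: n => [|n IH] /= [i [r ir]].
  by case: C_ind.1 => x; rewrite -[x]ir (zero_rV0 (i x)) linear0.
have [|||[w wE]|[w wE]] := @indec_local C
    (lcomp (lcomp r (linl _ _)) (lcomp (lfst _ _) i))
    (lcomp (lcomp r (linr _ _)) (lcomp (lsnd _ _) i)) => //.
- move=> x; rewrite /= -linearD -[RHS]ir; congr (r _).
  by rewrite [RHS]surjective_pairing; congr pair; rewrite ?addr0 ?add0r.
- have [|j jn Cj] := IH; last by exists j => //; apply: leqW.
  by exists (lcomp (lcomp (lfst _ _) i) w), (lcomp r (linl _ _)).
- exists n => //.
  by exists (lcomp (lcomp (lsnd _ _) i) w), (lcomp r (linr _ _)).
Qed.

Lemma indec_retract_iso C M : indec C -> indec M -> retract C M -> linear_iso C M.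
Proof.
move=> [C0 _] [_ M_ind] /retract_compl[D MCD].
have [//|D0] := M_ind C D MCD.
exact: liso_trans (liso_sym (liso_prodr0 _ D0)) (liso_sym MCD).
Qed.

(** An indecomposable summand of [B] is a summand of a power of [M], hence of a single [U j] by
    locality, hence isomorphic to it. *)
Lemma retract_msum M c (B : lmodType A) U q : fin_gen B ->
  (forall i, (i < q)%N -> indec (U i) /\ fin_gen (U i)) -> linear_iso M (dsum U q) ->
  retract B (dsum (fun=> M) c) -> exists v, linear_iso B (msum U v q).
Proof.
move=> B_fg U_ind MU BM.
have [n [F [F_ind BF]]] := decomposition B_fg.
have [|v vE] := @msum_of_dsum _ U q F n; last first.
  by exists v; apply: liso_trans BF vE.
move=> i iN; have [Fi_ind Fi_fg] := F_ind i iN.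
have FB : retract (F i) B.
  exact: retract_trans (dsum_retract F iN) (retract_iso (liso_sym BF)).
have [_ _ FM] := indec_retract Fi_ind Fi_fg (retract_trans FB BM).
have FU := retract_trans FM (retract_iso MU).
have [j jq Fj] := indec_retract Fi_ind Fi_fg FU.
by exists j => //; apply: indec_retract_iso Fj => //; apply: (U_ind j jq).1.
Qed.

End KrullSchmidt.

(** * Maps vanishing in high syzygies *)

Section StablyZero.
Context {R : comPzRingType} {A : pzRingType} (phi : {rmorphism R -> A}).
Hypothesis phi_artin : artin_algebra phi.
Implicit Types K M N P Q X : lmodType A.

Definition pcover K P M (f : {linear K -> P}) (g : {linear P -> M}) :=
  fgp P /\ short_exact f g.

Lemma coverP K P M (f : {linear K -> P}) (g : {linear P -> M}) : pcover f g ->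
  [/\ injective f, forall x, g (f x) = 0,
      forall y, g y = 0 -> exists x, f x = y & onto g].
Proof. by move=> [_ /short_exactP]. Qed.

Lemma cover_fg K P M (f : {linear K -> P}) (g : {linear P -> M}) :
  pcover f g -> fin_gen K.
Proof. by move=> [[_ P_fg] [f_inj _ _]]; apply: (fg_sub phi_artin f_inj). Qed.

Lemma cover_id P : fgp P -> pcover (lzero 'rV[A]_0 P) (lid P).
Proof.
move=> P_fgp; split=> //; apply/short_exactP; split=> // [x y _|y /= ->|x].
- by rewrite (zero_rV0 x) (zero_rV0 y).
- by exists 0.
- by exists x.
Qed.

Lemma cover_prod K P M K' P' M' (f : {linear K -> P}) (g : {linear P -> M})
    (f' : {linear K' -> P'}) (g' : {linear P' -> M'}) :
  pcover f g -> pcover f' g' -> pcover (lprod f f') (lprod g g').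
Proof.
move=> fg fg'; split; first by case: fg fg' => [? _] [? _]; apply: fgp_prod.
have [f_inj gf gK g_onto] := coverP fg; have [f_inj' gf' gK' g_onto'] := coverP fg'.
apply/short_exactP; split=> [[x x'] [y y'] /= [] /f_inj -> /f_inj' ->//|||].
- by move=> [x x'] /=; rewrite gf gf'.
- move=> [y y'] /= [/gK[x <-] /gK'[x' <-]]; by exists (x, x').
- by move=> [x x']; have [[y <-] [y' <-]] := (g_onto x, g_onto' x'); exists (y, y').
Qed.

(** A morphism of sequences, in which [h'] is induced by [h] on the kernels. *)
Definition lies_over M N K K' P Q (f : {linear K -> P}) (g : {linear P -> M})
  (f' : {linear K' -> Q}) (g' : {linear Q -> N}) (h : {linear M -> N})
  (u : {linear P -> Q}) (h' : {linear K -> K'}) :=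
  (forall x, u (f x) = f' (h' x)) /\ (forall x, g' (u x) = h (g x)).

Lemma over_ex M N K K' P Q (f : {linear K -> P}) (g : {linear P -> M})
    (f' : {linear K' -> Q}) (g' : {linear Q -> N}) (h : {linear M -> N}) :
  pcover f g -> short_exact f' g' -> exists u h', lies_over f g f' g' h u h'.
Proof.
move=> [[P_proj _] /short_exactP[_ gf _ _]] /short_exactP[f_inj' _ gK' g_onto'].
have [u uE] := proj_lift (lcomp h g) P_proj g_onto'.
have /(linear_lift f_inj')[h' h'E] : forall x, exists y, f' y = lcomp u f x.
  by move=> x; apply: gK'; rewrite /= uE /= gf linear0.
by exists u, h'; split=> // x; rewrite h'E.
Qed.

Lemma over_restrict M N K K' P Q (f : {linear K -> P}) (g : {linear P -> M})
    (f' : {linear K' -> Q}) (g' : {linear Q -> N}) (h : {linear M -> N})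
    (u : {linear P -> Q}) :
  short_exact f g -> short_exact f' g' -> (forall x, g' (u x) = h (g x)) ->
  exists h', lies_over f g f' g' h u h'.
Proof.
move=> /short_exactP[_ gf _ _] /short_exactP[f_inj' _ gK' g_onto'] uE.
have /(linear_lift f_inj')[h' h'E] : forall x, exists y, f' y = lcomp u f x.
  by move=> x; apply: gK'; rewrite /= uE /= gf linear0.
by exists h'; split=> // x; rewrite h'E.
Qed.

Definition syz_map M N K K' (h : {linear M -> N}) (h' : {linear K -> K'}) :=
  exists P Q (f : {linear K -> P}) (g : {linear P -> M})
    (f' : {linear K' -> Q}) (g' : {linear Q -> N}) (u : {linear P -> Q}),
  [/\ pcover f g, pcover f' g' & lies_over f g f' g' h u h'].

(* [stable0 n h] holds iff the n-th syzygy of [h] factors through a projective. *)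
Fixpoint stable0 n : forall M N, {linear M -> N} -> Prop :=
  if n is m.+1 then fun M N h =>
    exists K K' (h' : {linear K -> K'}), syz_map h h' /\ stable0 m h'
  else fun M N h =>
    exists P (u : {linear M -> P}) (v : {linear P -> N}),
      projective P /\ forall x, h x = v (u x).

Lemma stable0_ext n M N (h k : {linear M -> N}) :
  h =1 k -> stable0 n h -> stable0 n k.
Proof.
case: n => [|n] hk /=.
  by move=> [P [u [v [P_proj hE]]]]; exists P, u, v; split=> // x; rewrite -hk.
move=> [K [K' [h' [[P [Q [f [g [f' [g' [u [fg fg' [uf gu]]]]]]]]] h'0]]]].
exists K, K', h'; split=> //; exists P, Q, f, g, f', g', u; split=> //.
by split=> // x; rewrite gu hk.
Qed.

Lemma stable0_comp n M0 M N N0 (u : {linear M0 -> M}) (h : {linear M -> N})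
    (v : {linear N -> N0}) : fin_gen M0 -> fin_gen N0 ->
  stable0 n h -> stable0 n (lcomp v (lcomp h u)).
Proof.
elim: n M0 M N N0 u h v => [|n IH] M0 M N N0 u h v M0_fg N0_fg.
  move=> [P [a [b [P_proj hE]]]]; exists P, (lcomp a u), (lcomp v b).
  by split=> // x; rewrite /= hE.
move=> [K [K' [h' [[P [Q [f [g [f' [g' [w [fg fg' [wf gw]]]]]]]]] h'0]]]].
have [K0 [P0 [f0 [g0 fg0]]]] := cover_ex M0_fg.
have [K1 [P1 [f1 [g1 fg1]]]] := cover_ex N0_fg.
have [U [c [Uf gU]]] := over_ex u fg0 fg.2.
have [V [d [Vf gV]]] := over_ex v fg' fg1.2.
exists K0, K1, (lcomp d (lcomp h' c)); split; last first.
  by apply: IH h'0; [apply: cover_fg fg0 | apply: cover_fg fg1].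
exists P0, P1, f0, g0, f1, g1, (lcomp V (lcomp w U)); split=> //.
by split=> x /=; rewrite ?Uf ?wf ?Vf // gV gw gU.
Qed.

Lemma stable0_proj n M N P (u : {linear M -> P}) (v : {linear P -> N}) :
  fin_gen M -> fin_gen N -> projective P -> stable0 n (lcomp v u).
Proof.
elim: n M N P u v => [|n IH] M N P u v M_fg N_fg P_proj.
  by exists P, u, v.
have [K0 [P0 [f0 [g0 fg0]]]] := cover_ex M_fg.
have [K1 [P1 [f1 [g1 fg1]]]] := cover_ex N_fg.
have [_ gf _ _] := coverP fg0; have [_ _ _ g1_onto] := coverP fg1.
have [w wE] := proj_lift v P_proj g1_onto.
pose Z := 'rV[A]_0.
exists K0, K1, (lcomp (lzero Z K1) (lzero K0 Z)); split.
  exists P0, P1, f0, g0, f1, g1, (lcomp w (lcomp u g0)); split=> //.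
  by split=> x /=; rewrite ?gf ?linear0 // wE.
apply: IH; [exact: cover_fg fg0|exact: cover_fg fg1|exact: proj_free].
Qed.

(* Two maps induced on syzygies by the same map differ by one that factors
   through a projective. *)
Lemma over_unique M N K1 P1 K1' Q1 K2 P2 K2' Q2
    (f1 : {linear K1 -> P1}) (g1 : {linear P1 -> M})
    (f1' : {linear K1' -> Q1}) (g1' : {linear Q1 -> N})
    (f2 : {linear K2 -> P2}) (g2 : {linear P2 -> M})
    (f2' : {linear K2' -> Q2}) (g2' : {linear Q2 -> N}) h u1 h1 u2 h2 v d :
  short_exact f1 g1 -> pcover f2 g2 -> short_exact f2' g2' ->
  lies_over f1 g1 f1' g1' h u1 h1 -> lies_over f2 g2 f2' g2' h u2 h2 ->
  lies_over f1' g1' f2' g2' (lid N) v d ->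
  exists (c : {linear K2 -> K1}) (s : {linear P2 -> K2'}),
    forall x, h2 x = d (h1 (c x)) + s (f2 x).
Proof.
move=> fg1 fg2 fg2' [uf1 gu1] [uf2 gu2] [vf gv].
have [C [c [Cf gC]]] := over_ex (lid M) fg2 fg1.
have [f2'_inj _ g2'K _] := (short_exactP _ _).1 fg2'.
have /(linear_lift f2'_inj)[s sE] : forall x, exists y,
    f2' y = ladd u2 (lopp (lcomp v (lcomp u1 C))) x.
  by move=> x; apply: g2'K; rewrite linearB /= gu2 gv /= gu1 gC /= subrr.
exists c, s => x; apply: f2'_inj; rewrite linearD sE -vf -uf1 -Cf /= uf2.
by rewrite addrC addrNK.
Qed.

Section Additive.
Variable n : nat.
Hypothesis add_n : forall M N (h k : {linear M -> N}), fin_gen M -> fin_gen N ->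
  stable0 n h -> stable0 n k -> stable0 n (ladd h k).

(** Two induced maps differ by one through a projective, so the choice of covers is harmless. This
    uses additivity at level [n], while additivity at level [n.+1] uses this lemma; [stable0_add]
    runs the joint induction. *)
Lemma stable0_over_of_add M N K P K' Q (f : {linear K -> P}) (g : {linear P -> M})
    (f' : {linear K' -> Q}) (g' : {linear Q -> N}) h u h' :
  pcover f g -> short_exact f' g' -> fin_gen K' -> lies_over f g f' g' h u h' ->
  stable0 n.+1 h -> stable0 n h'.
Proof.
move=> fg fg' K'_fg hh'.
move=> [K1 [K1' [h1 [[P1 [Q1 [f1 [g1 [f1' [g1' [u1 [fg1 fg1' hh1]]]]]]]] h10]]]].
have [v [d vd]] := over_ex (lid N) fg1' fg'.
have [c [s h'E]] := over_unique fg1.2 fg fg' hh1 hh' vd.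
have K_fg := cover_fg fg.
apply: (@stable0_ext _ _ _ (ladd (lcomp d (lcomp h1 c)) (lcomp s f))) => //.
apply: add_n => //; first exact: stable0_comp.
exact: stable0_proj K_fg K'_fg fg.1.1.
Qed.
End Additive.

Lemma stable0_add n M N (h k : {linear M -> N}) : fin_gen M -> fin_gen N ->
  stable0 n h -> stable0 n k -> stable0 n (ladd h k).
Proof.
elim: n M N h k => [|n IH] M N h k M_fg N_fg.
  move=> [P [u [v [P_proj hE]]]] [Q [u' [v' [Q_proj kE]]]].
  exists (P * Q)%type, (lpair u u'), (lcopair v v'); split; first exact: proj_prod.
  by move=> x /=; rewrite hE kE.
move=> h0 k0.
have [K0 [P0 [f0 [g0 fg0]]]] := cover_ex M_fg.
have [K1 [P1 [f1 [g1 fg1]]]] := cover_ex N_fg.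
have [u [h' hh']] := over_ex h fg0 fg1.2; have [v [k' kk']] := over_ex k fg0 fg1.2.
have K1_fg := cover_fg fg1.
exists K0, K1, (ladd h' k'); split.
  exists P0, P1, f0, g0, f1, g1, (ladd u v); split=> //.
  case: hh' kk' => [uf gu] [vf gv].
  by split=> x; rewrite /= ?uf ?vf linearD // gu gv.
apply: (IH) => //; first exact: cover_fg fg0.
  exact: (stable0_over_of_add IH fg0 fg1.2 K1_fg hh' h0).
exact: (stable0_over_of_add IH fg0 fg1.2 K1_fg kk' k0).
Qed.

Lemma stable0_over n M N K P K' Q (f : {linear K -> P}) (g : {linear P -> M})
    (f' : {linear K' -> Q}) (g' : {linear Q -> N}) h u h' :
  pcover f g -> short_exact f' g' -> fin_gen K' -> lies_over f g f' g' h u h' ->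
  stable0 n.+1 h -> stable0 n h'.
Proof. by apply: stable0_over_of_add => *; apply: stable0_add. Qed.

Lemma stable0_mk n M N K P K' Q (f : {linear K -> P}) (g : {linear P -> M})
    (f' : {linear K' -> Q}) (g' : {linear Q -> N}) h u h' :
  pcover f g -> pcover f' g' -> lies_over f g f' g' h u h' ->
  stable0 n h' -> stable0 n.+1 h.
Proof.
by move=> fg fg' hh' h'0; exists K, K', h'; split=> //; exists P, Q, f, g, f', g', u.
Qed.

Lemma stable0_compr n M N N0 (h : {linear M -> N}) (v : {linear N -> N0}) :
  fin_gen M -> fin_gen N0 -> stable0 n h -> stable0 n (lcomp v h).
Proof.
move=> M_fg N0_fg /(stable0_comp (lid M) v M_fg N0_fg); exact: stable0_ext.
Qed.

Lemma stable0_compl n M0 M N (u : {linear M0 -> M}) (h : {linear M -> N}) :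
  fin_gen M0 -> fin_gen N -> stable0 n h -> stable0 n (lcomp h u).
Proof.
move=> M0_fg N_fg /(stable0_comp u (lid N) M0_fg N_fg); exact: stable0_ext.
Qed.

Lemma stable0_zero n M N : fin_gen M -> fin_gen N -> stable0 n (lzero M N).
Proof.
move=> M_fg N_fg.
have Z_proj : projective 'rV[A]_0 := @proj_free _ 0.
by apply: stable0_ext (stable0_proj n (lzero M _) (lzero _ N) M_fg N_fg Z_proj).
Qed.

Lemma stable0S n M N (h : {linear M -> N}) : fin_gen M -> fin_gen N ->
  stable0 n h -> stable0 n.+1 h.
Proof.
elim: n M N h => [|n IH] M N h M_fg N_fg.
  move=> [P [u [v [P_proj hE]]]].
  by apply: stable0_ext (stable0_proj 1 u v M_fg N_fg P_proj) => x; rewrite /= hE.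
move=> [K [K' [h' [hh' h'0]]]]; exists K, K', h'; split=> //.
case: hh' => [P [Q [f [g [f' [g' [u [fg fg' _]]]]]]]].
by apply: IH => //; [apply: cover_fg fg | apply: cover_fg fg'].
Qed.

Lemma stable0_le m n M N (h : {linear M -> N}) : fin_gen M -> fin_gen N ->
  (m <= n)%N -> stable0 m h -> stable0 n h.
Proof.
move=> M_fg N_fg /subnKC <-; elim: (n - m)%N => [|k IH]; rewrite ?addn0 // addnS.
by move=> h0; apply: stable0S => //; apply: IH.
Qed.

Lemma stable0_id_proj n P : fgp P -> stable0 n (lid P).
Proof.
move=> [P_proj P_fg].
by apply: stable0_ext (stable0_proj n (lid P) (lid P) P_fg P_fg P_proj).
Qed.

(* [stable0 n] holds for all maps [M -> N] that vanish in the stabilization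
   of the stable category. *)
Definition bounded n M N := forall m (h : {linear M -> N}),
  stable0 m h -> stable0 n h.

(** The conditions [stable0 k] cut out an ascending chain of R-submodules of the homomorphisms,
    which stops by [hom_chain]. *)
Lemma bounded_ex M N : fin_gen M -> fin_gen N -> exists n, bounded n M N.
Proof.
move=> M_fg N_fg.
apply: (hom_chain (phi_artin := phi_artin) (M := M) (N := N)
  (Q := fun k (h : {linear M -> N}) => stable0 k h)) => //.
- by move=> k f g; apply: stable0_ext.
- by move=> k; apply: stable0_zero.
- by move=> k r f g f0 g0; apply: stable0_add => //; apply: stable0_compr.
- by move=> k f; apply: stable0S.
Qed.

Lemma bounded_prodl n M M' N : fin_gen M -> fin_gen M' -> fin_gen N ->
  bounded n M N -> bounded n M' N -> bounded n (M * M')%type N.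
Proof.
move=> M_fg M'_fg N_fg b b' m h h0; have MM_fg := fg_prod M_fg M'_fg.
have h1 := b m _ (stable0_compl (linl M M') M_fg N_fg h0).
have h2 := b' m _ (stable0_compl (linr M M') M'_fg N_fg h0).
have := stable0_add MM_fg N_fg (stable0_compl (lfst M M') MM_fg N_fg h1)
  (stable0_compl (lsnd M M') MM_fg N_fg h2).
apply: stable0_ext => -[x y] /=; rewrite -linearD.
by congr (h _); congr pair; rewrite ?addr0 ?add0r.
Qed.

Lemma bounded_prodr n M N N' : fin_gen M -> fin_gen N -> fin_gen N' ->
  bounded n M N -> bounded n M N' -> bounded n M (N * N')%type.
Proof.
move=> M_fg N_fg N'_fg b b' m h h0; have NN_fg := fg_prod N_fg N'_fg.
have h1 := b m _ (stable0_compr (lfst N N') M_fg N_fg h0).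
have h2 := b' m _ (stable0_compr (lsnd N N') M_fg N'_fg h0).
have := stable0_add M_fg NN_fg (stable0_compr (linl N N') M_fg NN_fg h1)
  (stable0_compr (linr N N') M_fg NN_fg h2).
apply: stable0_ext => x /=; rewrite [RHS]surjective_pairing.
by congr pair; rewrite ?addr0 ?add0r.
Qed.

Lemma bounded_retract n M N M' N' : fin_gen M -> fin_gen N ->
  retract M' M -> retract N' N -> bounded n M N -> bounded n M' N'.
Proof.
move=> M_fg N_fg M'M N'N b m h.
have [M'_fg N'_fg] := (fg_retract M'M M_fg, fg_retract N'N N_fg).
move: M'M N'N => [i [r ir]] [j [s js]].
move=> /(stable0_comp r j M_fg N_fg)/b/(stable0_comp i s M'_fg N'_fg).
by apply: stable0_ext => x /=; rewrite ir js.
Qed.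

(** [stable0] can be tested on matrix entries, so the bound does not depend on the numbers of
    copies. *)
Lemma bounded_dsum n M N a b : fin_gen M -> fin_gen N -> bounded n M N ->
  bounded n (dsum (fun=> M) a) (dsum (fun=> N) b).
Proof.
move=> M_fg N_fg MN.
have zero_proj : projective 'rV[A]_0 by apply: proj_free.
have MD : bounded n M (dsum (fun=> N) b).
  elim: b => [|b IH] /=; last by apply: bounded_prodr => //; apply: fg_dsum.
  move=> m h _; have Z_fg := @fg_rV A 0.
  apply: stable0_ext (stable0_proj n h (lid _) M_fg Z_fg zero_proj) => //.
have N_fg' : fin_gen (dsum (fun=> N) b) by apply: fg_dsum.
elim: a => [|a IH] /=; last by apply: bounded_prodl => //; apply: fg_dsum.
move=> m h _; have Z_fg := @fg_rV A 0.
by apply: stable0_ext (stable0_proj n (lid _) h Z_fg N_fg' zero_proj).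
Qed.

End StablyZero.

(** * Syzygies of exact sequences *)

Section Syzygies.
Context {R : comPzRingType} {A : pzRingType} (phi : {rmorphism R -> A}).
Hypothesis phi_artin : artin_algebra phi.
Implicit Types K M N P Q X Y D B C G FB FD KB KD : lmodType A.

(* Syzygies with respect to arbitrary, not necessarily minimal, covers. *)
Fixpoint syz n M K : Prop :=
  if n is m.+1 then exists M1 P (f : {linear M1 -> P}) (g : {linear P -> M}),
    pcover f g /\ syz m M1 K
  else M = K.

Lemma syz_fg n M K : fin_gen M -> syz n M K -> fin_gen K.
Proof.
elim: n M => [|n IH] M M_fg /= => [<- //|[M1 [P [f [g [fg]]]]]].
by apply: IH; apply: (cover_fg phi_artin fg).
Qed.

Lemma syz_ex n M : fin_gen M -> exists K, syz n M K.
Proof.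
elim: n M => [|n IH] M M_fg; first by exists M.
have [M1 [P [f [g fg]]]] := cover_ex M_fg.
have [K M1K] := IH M1 (cover_fg phi_artin fg).
by exists K, M1, P, f, g.
Qed.

Lemma syz_trans m n M N K : syz m M N -> syz n N K -> syz (m + n) M K.
Proof.
elim: m M => [|m IH] M /= => [->//|[M1 [P [f [g [fg M1N]]]]] NK].
by exists M1, P, f, g; split=> //; apply: IH.
Qed.

Lemma syz_prod n M K M' K' : syz n M K -> syz n M' K' ->
  syz n (M * M')%type (K * K')%type.
Proof.
elim: n M M' => [|n IH] M M' /= => [-> ->//|].
move=> [M1 [P [f [g [fg MK]]]]] [M1' [P' [f' [g' [fg' MK']]]]].
exists (M1 * M1')%type, (P * P')%type, (lprod f f'), (lprod g g').
by split; [apply: cover_prod | apply: IH].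
Qed.

(** The cover of [Q] by [Q * Q] has kernel [Q]; projective summands can thus be carried unchanged
    through all syzygies. *)
Lemma syz_fgp n Q : fgp Q -> syz n Q Q.
Proof.
move=> Q_fgp; elim: n => //= n IH.
exists Q, (Q * Q)%type, (linl Q Q), (lsnd Q Q); split=> //; split.
  exact: fgp_prod.
apply/short_exactP; split=> [x y /= []|//|[x y] /= ->|x] //; first by exists x.
by exists (0, x).
Qed.

Lemma syz_dsum n (F H : nat -> lmodType A) k :
  (forall i, (i < k)%N -> syz n (F i) (H i)) -> syz n (dsum F k) (dsum H k).
Proof.
elim: k => [|k IH] FH /=; first by apply: syz_fgp; apply: fgp_rV.
by apply: syz_prod; [apply: IH => i /ltnW; apply: FH | apply: FH].
Qed.

Lemma cover_isor K P M N (f : {linear K -> P}) (g : {linear P -> M}) :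
  pcover f g -> linear_iso M N -> exists g' : {linear P -> N}, pcover f g'.
Proof.
move=> fg /liso_ex[h [h' [hK hK']]]; have [f_inj gf gK g_onto] := coverP fg.
exists (lcomp h g); split; [by case: fg|apply/short_exactP; split=> // [x|y|y] /=].
- by rewrite gf linear0.
- by rewrite -(linear0 h) => /(can_inj hK)/gK.
- by have [x xE] := g_onto (h' y); exists x; rewrite xE hK'.
Qed.

Lemma cover_isol K K' P M (f : {linear K -> P}) (g : {linear P -> M}) :
  pcover f g -> linear_iso K K' -> exists f' : {linear K' -> P}, pcover f' g.
Proof.
move=> fg /liso_ex[h [h' [hK hK']]]; have [f_inj gf gK g_onto] := coverP fg.
exists (lcomp f h'); split; [by case: fg|apply/short_exactP; split=> // [x y|x|y] /=].
- by move=> /f_inj/(can_inj hK').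
- exact: gf.
- by move=> /gK[x <-]; exists (h x); rewrite hK.
Qed.

(** Level 0 is excluded because [syz 0] is equality of modules, not isomorphism. *)
Lemma syz_isol n M N K : linear_iso M N -> syz n.+1 M K -> syz n.+1 N K.
Proof.
move=> MN [M1 [P [f [g [fg M1K]]]]]; have [g' fg'] := cover_isor fg MN.
by exists M1, P, f, g'.
Qed.

Lemma syz_isor n M K K' : linear_iso K K' -> syz n.+1 M K -> syz n.+1 M K'.
Proof.
move=> KK'; elim: n M => [|n IH] M [M1 [P [f [g [fg M1K]]]]]; last first.
  by exists M1, P, f, g; split=> //; apply: IH.
move: M1K => /= M1K; subst M1; have [f' fg'] := cover_isol fg KK'.
by exists K', P, f', g.
Qed.

Lemma syz_absorb n M K Q : syz n.+1 M K -> fgp Q -> syz n.+1 M (K * Q)%type.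
Proof.
move=> MK Q_fgp; elim: n M MK => [|n IH] M [M1 [P [f [g [fg M1K]]]]]; last first.
  by exists M1, P, f, g; split=> //; apply: IH.
move: M1K => /= M1K; subst M1; have [f_inj gf gK g_onto] := coverP fg.
exists (K * Q)%type, (P * Q)%type, (lprod f (lid Q)), (lcomp g (lfst P Q)).
split=> //; split; first by apply: fgp_prod => //; case: fg.
apply/short_exactP; split=> [[x y] [x' y'] /= [/f_inj-> ->]|[x y]|[x y] /=|x] //=.
- by move=> /gK[z <-]; exists (z, y).
- by have [y <-] := g_onto x; exists (y, 0).
Qed.

Lemma schanuel M K P K' P' (f : {linear K -> P}) (g : {linear P -> M})
    (f' : {linear K' -> P'}) (g' : {linear P' -> M}) :
  short_exact f g -> short_exact f' g' -> projective P -> projective P' ->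
  linear_iso (K * P')%type (K' * P)%type.
Proof.
move=> /short_exactP[f_inj gf gK g_onto] /short_exactP[f'_inj gf' gK' g'_onto].
move=> P_proj P'_proj.
(* The kernel of [d] is the pullback of [g] and [g']. It maps onto [P] with kernel [K'] and onto
   [P'] with kernel [K], and both maps split. *)
pose d := ladd (lcomp g (lfst P P')) (lopp (lcomp g' (lsnd P P'))).
have [X [x [x_inj xE]]] := submod_ex (ker_submod d).
have dE a b : (exists z, x z = (a, b)) <-> g a = g' b.
  by split=> [/xE/eqP|gab]; [|apply/xE]; rewrite /d /= ?gab ?subrr // subr_eq0 => /eqP.
have xgg z : g (x z).1 = g' (x z).2 by apply/dE; exists z; case: (x z).
have : linear_iso X (K' * P)%type /\ linear_iso X (K * P')%type.
  split.
    have /(linear_lift x_inj)[k kE] : forall y, exists z, x z = lcomp (linr P P') f' y.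
      by move=> y; apply/dE; rewrite linear0 gf'.
    apply: (@proj_split _ P K' X k (lcomp (lfst _ _) x)) => //.
    apply/short_exactP; split=> [y y' /(congr1 x)|y|z /= z0|a].
    - by rewrite !kE => -[/f'_inj].
    - by rewrite /= kE.
    - have [y yE] : exists y, f' y = (x z).2 by apply: gK'; rewrite -xgg z0 linear0.
      by exists y; apply: x_inj; rewrite kE [RHS]surjective_pairing z0 /= yE.
    - have [b bE] := g'_onto (g a).
      by have [z zE] := (dE a b).2 (esym bE); exists z; rewrite /= zE.
  have /(linear_lift x_inj)[k kE] : forall y, exists z, x z = lcomp (linl P P') f y.
    by move=> y; apply/dE; rewrite linear0 gf.
  apply: (@proj_split _ P' K X k (lcomp (lsnd _ _) x)) => //.
  apply/short_exactP; split=> [y y' /(congr1 x)|y|z /= z0|b].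
  - by rewrite !kE => -[/f_inj].
  - by rewrite /= kE.
  - have [y yE] : exists y, f y = (x z).1 by apply: gK; rewrite xgg z0 linear0.
    by exists y; apply: x_inj; rewrite kE [RHS]surjective_pairing z0 /= yE.
  - have [a aE] := g_onto (g' b).
    by have [z zE] := (dE a b).2 aE; exists z; rewrite /= zE.
by move=> [X1 X2]; apply: liso_trans (liso_sym X2) X1.
Qed.

Lemma syz_unique n M M' K K' : linear_iso M M' -> syz n M K -> syz n M' K' ->
  exists P P', [/\ fgp P, fgp P' & linear_iso (K * P)%type (K' * P')%type].
Proof.
elim: n M M' K K' => [|n IH] M M' K K' MM'.
  move=> /= <- <-; exists 'rV[A]_0, 'rV[A]_0; split; try exact: fgp_rV.
  exact: liso_prod MM' (liso_refl _).
move=> [M1 [P [f [g [fg M1K]]]]] [M1' [P' [f' [g' [fg' M1K']]]]].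
have [g2 fg2] := cover_isor fg MM'.
have M1E := schanuel fg2.2 fg'.2 fg2.1.1 fg'.1.1.
have [||Q [Q' [Q_fgp Q'_fgp KQ]]] := IH _ _ (K * P')%type (K' * P)%type M1E.
- by apply: syz_prod => //; apply: syz_fgp; case: fg'.
- by apply: syz_prod => //; apply: syz_fgp; case: fg.
exists (P' * Q)%type, (P * Q')%type.
split; [by apply: fgp_prod=> //; case: fg'|by apply: fgp_prod=> //; case: fg|].
exact: liso_trans (liso_prodA _ _ _) (liso_trans KQ (liso_sym (liso_prodA _ _ _))).
Qed.

Lemma over_id K P M (f : {linear K -> P}) (g : {linear P -> M}) :
  lies_over f g f g (lid M) (lid P) (lid K).
Proof. by []. Qed.

(** For finitely generated modules [stable0 m (lid M)] means projective dimension at most [m], by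
    [pr_stable0] and [stable0_pr]; this is dimension shifting. *)
Lemma syz_stable0 m n M K : syz n M K -> stable0 m (lid K) -> stable0 (n + m) (lid M).
Proof.
elim: n M => [|n IH] M /= => [->//|[M1 [P [f [g [fg M1K]]]]] K0].
exact: (stable0_mk fg fg (over_id f g) (IH _ M1K K0)).
Qed.

Lemma syz_stable0_inv m n M K : fin_gen M -> syz n M K ->
  stable0 (n + m) (lid M) -> stable0 m (lid K).
Proof.
elim: n M => [|n IH] M M_fg => [/= -> //|[M1 [P [f [g [fg M1K]]]]] M0].
have M1_fg := cover_fg phi_artin fg; apply: (IH M1) => //.
exact: (stable0_over phi_artin fg fg.2 M1_fg (over_id f g)) M0.
Qed.

Lemma stable0_id0 M : stable0 0 (lid M) -> projective M.
Proof.
move=> [P [u [v [P_proj uv]]]]; apply: proj_retract P_proj.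
by exists u, v => x; rewrite -uv.
Qed.

(** Each step uses one cover for both source and target, so that iterates of [e1] lie over iterates
    of [e]; [syz_map] allows two different covers. *)
Inductive endo_syz : nat ->
  forall X X', {linear X -> X} -> {linear X' -> X'} -> Prop :=
| EndoSyz0 X (e e' : {linear X -> X}) : e =1 e' -> endo_syz 0 e e'
| EndoSyzS n X X1 X' P (f : {linear X1 -> P}) (g : {linear P -> X}) e u e1
    (e' : {linear X' -> X'}) : pcover f g -> lies_over f g f g e u e1 ->
    endo_syz n e1 e' -> endo_syz n.+1 e e'.

Lemma endo_syz_stable0 m n X X' (e : {linear X -> X}) (e' : {linear X' -> X'}) :
  endo_syz n e e' -> stable0 m e' -> stable0 (n + m) e.
Proof.
elim=> {n X X' e e'} [X e e' ee'|n X X1 X' P f g e u e1 e' fg ov _ IH] e'0.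
  by apply: stable0_ext e'0 => x; rewrite ee'.
exact: (stable0_mk fg fg ov (IH e'0)).
Qed.

Lemma endo_syz_stable0_inv m n X X' (e : {linear X -> X}) (e' : {linear X' -> X'}) :
  endo_syz n e e' -> fin_gen X -> stable0 (n + m) e -> stable0 m e'.
Proof.
elim=> {n X X' e e'} [X e e' ee'|n X X1 X' P f g e u e1 e' fg ov _ IH] X_fg e0.
  exact: stable0_ext e0.
have X1_fg := cover_fg phi_artin fg; apply: (IH X1_fg).
exact: (stable0_over phi_artin fg fg.2 X1_fg ov) e0.
Qed.

Lemma endo_syz_iter k n X X' (e : {linear X -> X}) (e' : {linear X' -> X'}) :
  endo_syz n e e' -> endo_syz n (liter k e) (liter k e').
Proof.
elim=> {n X X' e e'} [X e e' ee'|n X X1 X' P f g e u e1 e' fg [uf gu] _ IH].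
  by apply: EndoSyz0 => x /=; elim: k => //= k ->.
apply: (EndoSyzS fg _ IH (u := liter k u)).
by split=> x /=; [elim: k {IH} => //= k ->; rewrite uf | elim: k {IH} => //= k <-; rewrite gu].
Qed.

Lemma endo_syz_syz n X X' (e : {linear X -> X}) (e' : {linear X' -> X'}) :
  endo_syz n e e' -> syz n X X'.
Proof.
elim=> {n X X' e e'} [//|n X X1 X' P f g e u e1 e' fg _ _ IH].
by exists X1, P, f, g.
Qed.

Lemma cover_extend B G B1 FB (f : {linear B1 -> FB}) (g : {linear FB -> B}) :
  pcover f g -> fgp G ->
  pcover (lprod f (lzero 'rV[A]_0 G)) (lprod g (lid G)).
Proof. by move=> fg G_fgp; apply: cover_prod fg (cover_id G_fgp). Qed.

(* One syzygy step on [0 -> D -> B * G -> X -> 0]: the new sequence is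
   [0 -> D1 -> B1 * FD -> X1 -> 0]. *)
Lemma seq_step D B G X D1 FD B1 FB (i : {linear D -> (B * G)%type})
    (p : {linear (B * G)%type -> X}) (fD : {linear D1 -> FD}) (gD : {linear FD -> D})
    (fB : {linear B1 -> FB}) (gB : {linear FB -> B}) :
  short_exact i p -> pcover fD gD -> pcover fB gB -> fgp G ->
  exists X1 (j : {linear X1 -> (FB * G)%type}) (i1 : {linear D1 -> (B1 * FD)%type})
    (p1 : {linear (B1 * FD)%type -> X1}) (I : {linear FD -> (FB * G)%type}),
  [/\ pcover j (lcomp p (lprod gB (lid G))), short_exact i1 p1,
    forall u, lprod gB (lid G) (I u) = i (gD u),
    forall b u, j (p1 (b, u)) = I u - (fB b, 0)
  & forall x, (i1 x).2 = fD x /\ I (fD x) = (fB (i1 x).1, 0)].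
Proof.
move=> ip fgD fgB G_fgp; have fgBG := cover_extend fgB G_fgp.
have [i_inj pi pK p_onto] := (short_exactP _ _).1 ip.
have [fD_inj gfD gKD gD_onto] := coverP fgD.
have [fB_inj gfB gKB gB_onto] := coverP fgB.
have [_ gfBG gKBG gBG_onto] := coverP fgBG.
set g := lprod gB (lid G) in gfBG gKBG gBG_onto fgBG *.
(* [X1] is the kernel of the composite cover of [X], and [I] lifts [i] to the covers. The map onto
   [X1] is the difference of [I] and [fB]. *)
have pg_onto : onto (lcomp p g).
  by move=> z; have [y <-] := p_onto z; have [x <-] := gBG_onto y; exists x.
have [X1 [j j_pg]] := ker_ex pg_onto.
have [j_inj pgj jK _] := (short_exactP _ _).1 j_pg.
have [I IE] := proj_lift (lcomp i gD) fgD.1.1 gBG_onto.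
have I2 x : (I (fD x)).2 = 0.
  by have /(congr1 snd) := IE (fD x); rewrite /= gfD linear0.
have /(linear_lift fB_inj)[b bE] : forall x, exists y,
    fB y = lcomp (lfst _ _) (lcomp I fD) x.
  move=> x; apply: gKB; have /(congr1 fst) := IE (fD x).
  by rewrite /= gfD linear0.
have IfD x : I (fD x) = (fB (b x), 0) by rewrite bE [LHS]surjective_pairing I2.
pose q := ladd (lcomp I (lsnd B1 FD)) (lopp (lcomp (linl FB G) (lcomp fB (lfst B1 FD)))).
have /(linear_lift j_inj)[p1 p1E] : forall x, exists y, j y = q x.
  move=> [y u]; apply: jK.
  rewrite -[q (y, u)]/(I u - lprod fB (lzero 'rV[A]_0 G) (y, 0)) linearB /=.
  by rewrite -[p (_, _)]/(p (g (I u))) IE pi gfB linear0 sub0r oppr0.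
exists X1, j, (lpair b fD), p1, I; split=> //.
- by split=> //; apply: fgp_prod => //; case: fgB.
- apply/short_exactP; split=> [x y /= [_ /fD_inj]//|x|[y u] yu|x].
  + by apply: j_inj; rewrite p1E /= IfD subrr linear0.
  + have qyu : I u = (fB y, 0).
      have := p1E (y, u); rewrite yu linear0 /= => /esym/eqP.
      by rewrite subr_eq0 => /eqP.
    have /gKD[x xE] : gD u = 0.
      apply: i_inj; rewrite -[i (gD u)]/(lcomp i gD u) -IE qyu /= gfB linear0.
      by [].
    exists x; rewrite /= xE; congr pair; apply: fB_inj.
    by move: (IfD x); rewrite xE qyu => -[].
  + have : lcomp p g (j x) = 0 by rewrite pgj.
    move=> /= /pK[a aE]; have [u uE] := gD_onto a.
    have [[y z] yE] : exists y, lprod fB (lzero 'rV[A]_0 G) y = I u - j x.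
      by apply: gKBG; rewrite linearB IE /= uE aE subrr.
    exists (y, u); apply: j_inj; rewrite p1E /=.
    by rewrite -[(fB y, 0)]/(lprod fB (lzero 'rV[A]_0 G) (y, z)) yE opprB addrC addrNK.
Qed.

(** The syzygies of [D] and [B] can be prescribed; only the projective [G'] and the cokernel are
    new. This allows one module to appear in both places. *)
Lemma seq_syz n D B G X KD KB (i : {linear D -> (B * G)%type})
    (p : {linear (B * G)%type -> X}) :
  short_exact i p -> fgp G -> syz n D KD -> syz n B KB ->
  exists G' X' (i' : {linear KD -> (KB * G')%type}) (p' : {linear (KB * G')%type -> X'}),
  [/\ short_exact i' p', fgp G' & syz n X X'].
Proof.
elim: n D B G X i p => [|n IH] D B G X i p ip G_fgp.
  by move=> /= <- <-; exists G, X, i, p.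
move=> [D1 [FD [fD [gD [fgD DK]]]]] [B1 [FB [fB [gB [fgB BK]]]]].
have [X1 [j [i1 [p1 [_ [j_cov ip1 _ _ _]]]]]] := seq_step ip fgD fgB G_fgp.
have [G' [X' [i' [p' [ip' G'_fgp X1X']]]]] := IH _ _ _ _ i1 p1 ip1 fgD.1 DK BK.
exists G', X', i', p'; split=> //.
by exists X1, (FB * G)%type, j, (lcomp p (lprod gB (lid G))).
Qed.

(** Using the same cover for both copies of [C] makes the component of [i'] on [C'] a syzygy of the
    component of [i] on [C]. *)
Lemma seq_endo_syz n C G X (i : {linear C -> (C * G)%type})
    (p : {linear (C * G)%type -> X}) : fin_gen C -> short_exact i p -> fgp G ->
  exists C' G' X' (i' : {linear C' -> (C' * G')%type})
    (p' : {linear (C' * G')%type -> X'}),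
  [/\ short_exact i' p', fgp G', syz n X X' &
      endo_syz n (lcomp (lfst C G) i) (lcomp (lfst C' G') i')].
Proof.
elim: n C G X i p => [|n IH] C G X i p C_fg ip G_fgp.
  by exists C, G, X, i, p; split=> //; apply: EndoSyz0.
have [C1 [F [f [g fg]]]] := cover_ex C_fg.
have [X1 [j [i1 [p1 [I [j_cov ip1 IE _ i1E]]]]]] := seq_step ip fg fg G_fgp.
have [C' [G' [X' [i' [p' [ip' G'_fgp X1X' ii']]]]]] :=
  IH C1 F X1 i1 p1 (cover_fg phi_artin fg) ip1 fg.1.
exists C', G', X', i', p'; split=> //.
  by exists X1, (F * G)%type, j, (lcomp p (lprod g (lid G))).
apply: (EndoSyzS fg _ ii' (u := lcomp (lfst F G) I)); split=> x /=.
  by rewrite (i1E x).2.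
by have /(congr1 fst) := IE x.
Qed.

(* [obstr n i p e]: the obstruction to lifting [e] along [p], a map from a
   syzygy of the middle term to [D], is [stable0 n]. *)
Definition obstr n D M X (i : {linear D -> M}) (p : {linear M -> X})
    (e : {linear X -> X}) :=
  forall K P (f : {linear K -> P}) (g : {linear P -> M}) t w,
    pcover f g -> lies_over f g i p (lcomp e p) t w -> stable0 n w.

(** One cover and one pair of lifts suffice, since any other obstruction differs by a map through a
    projective. *)
Lemma obstr_indep n D M X (i : {linear D -> M}) (p : {linear M -> X}) e
    K P (f : {linear K -> P}) (g : {linear P -> M}) t w :
  fin_gen D -> short_exact i p -> pcover f g -> lies_over f g i p (lcomp e p) t w ->
  stable0 n w -> obstr n i p e.
Proof.
move=> D_fg ip fg tw w0 K' P' f' g' t' w' fg' tw'.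
have [c [s w'E]] := over_unique fg.2 fg' ip tw tw' (over_id i p).
have K'_fg := cover_fg phi_artin fg'.
suff : stable0 n (ladd (lcomp w c) (lcomp s f')).
  by apply: stable0_ext => x; rewrite w'E.
apply: (stable0_add phi_artin) => //.
  exact: (stable0_compl phi_artin c K'_fg D_fg w0).
exact: (stable0_proj phi_artin n f' s K'_fg D_fg fg'.1.1).
Qed.

Lemma obstr_stable0 n D M X (i : {linear D -> M}) (p : {linear M -> X}) e :
  fin_gen D -> fin_gen M -> fin_gen X -> short_exact i p ->
  stable0 n.+1 e -> obstr n i p e.
Proof.
move=> D_fg M_fg X_fg ip e0 K P f g t w fg tw.
apply: (stable0_over phi_artin fg ip D_fg tw).
exact: (stable0_compl phi_artin p M_fg X_fg e0).
Qed.

(** The last clause isolates the obstruction. On [FD], which is projective, [e1] always lifts; over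
    [Y] it lifts once [- w] restricted to [Y] lifts along [gD]. The clause is applied with [y] an
    identity when [w] factors through a projective, and with [y] a cover to find the next
    obstruction. *)
Lemma seq_step_lift D B G X D1 FD B1 FB (i : {linear D -> (B * G)%type})
    (p : {linear (B * G)%type -> X}) (e : {linear X -> X})
    (fD : {linear D1 -> FD}) (gD : {linear FD -> D})
    (fB : {linear B1 -> FB}) (gB : {linear FB -> B}) :
  short_exact i p -> pcover fD gD -> pcover fB gB -> fgp G ->
  exists t (w : {linear (B1 * 'rV[A]_0)%type -> D}) X1
    (j : {linear X1 -> (FB * G)%type}) (i1 : {linear D1 -> (B1 * FD)%type})
    (p1 : {linear (B1 * FD)%type -> X1}) E e1,
  let pg := lcomp p (lprod gB (lid G)) in
  [/\ lies_over (lprod fB (lzero 'rV[A]_0 G)) (lprod gB (lid G)) i p (lcomp e p) t w,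
      pcover j pg /\ lies_over j pg j pg e E e1,
      short_exact i1 p1, forall x, (i1 x).2 = fD x
    & forall Y (y : {linear Y -> B1}) (v : {linear Y -> FD}),
        (forall x, gD (v x) = - w (y x, 0)) ->
        exists s : {linear (Y * FD)%type -> (B1 * FD)%type},
          (forall x u, p1 (s (x, u)) = e1 (p1 (y x, u))) /\
          (forall x, (s (x, 0)).2 = v x)].
Proof.
move=> ip fgD fgB G_fgp.
have [X1 [j [i1 [p1 [I [j_cov ip1 IE p1E i1E]]]]]] := seq_step ip fgD fgB G_fgp.
have fgBG := cover_extend fgB G_fgp; have [t [w tw]] := over_ex (lcomp e p) fgBG ip.
have [fBG_inj gfBG gKBG gBG_onto] := coverP fgBG.
have [E EE] := proj_lift t fgBG.1.1 gBG_onto.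
have [|e1 e1E] := over_restrict (h := e) (u := E) j_cov.2 j_cov.2.
  by move=> x; rewrite /= -[p (_, _)]/(p (lprod gB (lid G) (E x))) EE tw.2.
have [j_inj _ _ _] := coverP j_cov; have [_ _ _ gD_onto] := coverP fgD.
have [_ _ _ p1_onto] := (short_exactP _ _).1 ip1.
exists t, w, X1, j, i1, p1, E, e1; split=> // [x|Y y v vE]; first by rewrite (i1E x).1.
pose F := lprod fB (lzero 'rV[A]_0 G); pose Fy := lcomp F (lcomp (linl _ _) y).
have /(linear_lift fBG_inj)[k kE] : forall x, exists z,
    F z = ladd (lcomp I v) (lcomp E Fy) x.
  move=> x; apply: gKBG; rewrite linearD /=.
  rewrite -[(gB _, _)]/(lprod gB (lid G) (I (v x))) IE vE linearN.
  by rewrite -[(gB _, _)]/(lprod gB (lid G) (E (F (y x, 0)))) EE tw.1 addNr.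
have [r rE] := proj_lift (lcomp e1 (lcomp p1 (linr B1 FD))) fgD.1.1 p1_onto.
pose s := lpair (lcomp (lfst _ _) k) v.
have sE x : p1 (s x) = e1 (p1 (y x, 0)).
  apply: j_inj; rewrite -e1E.1 !p1E linear0 sub0r linearN.
  have -> : (fB (lcomp (lfst _ _) k x), 0) = I (v x) + E (F (y x, 0)).
    by rewrite -[RHS]kE.
  by rewrite opprD addrA subrr sub0r.
exists (lcopair s r); split=> [x u|x]; last by rewrite /= linear0 addr0.
rewrite linearD /= sE rE -!linearD /=.
by congr (e1 (p1 _)); congr pair; rewrite ?addr0 ?add0r.
Qed.

(* An obstruction factoring through a projective [Q] vanishes after one more
   syzygy, because [Q] has syzygy 0. *)
Lemma seq_lift n D B G X KD KB (i : {linear D -> (B * G)%type})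
    (p : {linear (B * G)%type -> X}) (e : {linear X -> X}) :
  fin_gen D -> fin_gen B -> short_exact i p -> fgp G ->
  syz n.+1 D KD -> syz n.+1 B KB -> obstr n i p e ->
  exists G' X' (i' : {linear KD -> (KB * G')%type}) (p' : {linear (KB * G')%type -> X'})
    (e' : {linear X' -> X'}) (b : {linear (KB * G')%type -> (KB * G')%type}),
  [/\ short_exact i' p', fgp G', endo_syz n.+1 e e' & forall x, p' (b x) = e' (p' x)].
Proof.
elim: n D B G X i p e => [|n IH] D B G X i p e D_fg B_fg ip G_fgp.
  move=> [D1 [FD [fD [gD [fgD /= DK]]]]] [B1 [FB [fB [gB [fgB /= BK]]]]] ob.
  subst D1 B1.
  have fgBG := cover_extend fgB G_fgp; have [_ _ _ gD_onto] := coverP fgD.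
  have [t [w [X1 [j [i1 [p1 [E [e1 [tw [j_cov je1] ip1 _ lift]]]]]]]]] :=
    seq_step_lift e ip fgD fgB G_fgp.
  (* The factor [v] of [w], starting at a projective, lifts to the cover [FD]. *)
  have [Q [u [v [Q_proj wE]]]] := ob _ _ _ _ _ _ fgBG tw.
  have [V VE] := proj_lift v Q_proj gD_onto.
  have [|b [bE _]] := lift KB (lid KB) (lopp (lcomp V (lcomp u (linl _ _)))).
    by move=> x; rewrite linearN /= VE wE.
  exists FD, X1, i1, p1, e1, b; split=> //; first by case: fgD.
    by apply: (EndoSyzS j_cov je1); apply: EndoSyz0.
  by move=> [x z]; rewrite bE.
move=> [D1 [FD [fD [gD [fgD DK]]]]] [B1 [FB [fB [gB [fgB BK]]]]] ob.
have fgBG := cover_extend fgB G_fgp; have [_ _ _ gD_onto] := coverP fgD.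
have [t [w [X1 [j [i1 [p1 [E [e1 [tw [j_cov je1] ip1 i1E lift]]]]]]]]] :=
  seq_step_lift e ip fgD fgB G_fgp.
have D1_fg := cover_fg phi_artin fgD; have B1_fg := cover_fg phi_artin fgB.
have w0 := ob _ _ _ _ _ _ fgBG tw.
suff ob1 : obstr n i1 p1 e1.
  have [G' [X' [i' [p' [e' [b [ip' G'_fgp ee' bE]]]]]]] :=
    IH _ _ _ _ i1 p1 e1 D1_fg B1_fg ip1 fgD.1 DK BK ob1.
  exists G', X', i', p', e', b; split=> //.
  exact: (EndoSyzS j_cov je1).
(* The obstruction for [e1] is, up to sign, the syzygy of [w], so its level drops from [n.+1] to
   [n]. *)
have [B2 [F2 [f2 [g2 fg2]]]] := cover_ex B1_fg.
have [v vE] := proj_lift (lopp (lcomp w (lcomp (linl _ _) g2))) fg2.1.1 gD_onto.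
have [//|s [sE s2]] := lift F2 g2 v.
have fg2F := cover_extend fg2 fgD.1.
have [|w1 w1E] := over_restrict (h := lcomp e1 p1) (u := s) fg2F.2 ip1.
  by move=> [x z]; rewrite sE.
apply: (obstr_indep D1_fg ip1 fg2F w1E).
have w1l : lies_over f2 g2 fD gD (lopp (lcomp w (linl _ _))) v (lcomp w1 (linl _ _)).
  by split=> x; [rewrite -i1E -w1E.1 /= -s2 | rewrite vE].
have w1l0 : stable0 n (lcomp w1 (linl _ _)).
  apply: (stable0_over phi_artin fg2 fgD.2 D1_fg w1l).
  have wl0 := stable0_compl phi_artin (linl _ _) B1_fg D_fg w0.
  have := stable0_compr phi_artin (lopp (lid D)) B1_fg D_fg wl0.
  exact: stable0_ext.
have B2Z_fg := cover_fg phi_artin fg2F.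
have := stable0_compl phi_artin (lfst _ _) B2Z_fg D1_fg w1l0.
by apply: stable0_ext => -[x z] /=; rewrite (zero_rV0 z).
Qed.

End Syzygies.

(** * The Igusa-Todorov bound *)

(** Induction on the number of coordinates. The family [s], chosen without regard to the last
    coordinate, handles the vectors whose last coordinate is at least [c0]; the finitely many
    smaller values are treated one at a time. *)
Lemma dickson q (E : (nat -> nat) -> Prop) :
  exists n (s : nat -> nat -> nat), (forall l, (l < n)%N -> E (s l)) /\
    forall v, E v -> exists2 l, (l < n)%N & forall i, (i < q)%N -> (s l i <= v i)%N.
Proof.
elim: q E => [|q IH] E.
  have [[v Ev]|nE] := pselect (exists v, E v).
    by exists 1%N, (fun=> v); split=> // w _; exists 0%N.
  by exists 0%N, (fun _ _ => 0%N); split=> // v Ev; case: nE; exists v.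
have [n [s [sE sv]]] := IH E; pose c0 := \max_(l < n) s l q.
suff low c : exists n' (s' : nat -> nat -> nat), (forall l, (l < n')%N -> E (s' l)) /\
    forall v, E v -> (v q < c)%N ->
    exists2 l, (l < n')%N & forall i, (i < q.+1)%N -> (s' l i <= v i)%N.
  have [n' [s' [sE' sv']]] := low c0.
  exists (n + n')%N, (fun l => if (l < n)%N then s l else s' (l - n)%N).
  split=> [l ln|v Ev]; first by case: ltnP => nl; [apply: sE | apply: sE'; rewrite ltn_subLR].
  have [vq|vq] := ltnP (v q) c0.
    have [l ln lv] := sv' v Ev vq; exists (n + l)%N; rewrite ?ltn_add2l //.
    by rewrite ltnNge leq_addr addKn.
  have [l ln lv] := sv v Ev; exists l; rewrite ?ln ?ltn_addr // => i.
  rewrite ltnS leq_eqVlt => /predU1P[->|/lv//].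
  by apply: leq_trans vq; apply: (leq_bigmax (Ordinal ln)).
elim: c => [|c [n' [s' [sE' sv']]]].
  by exists 0%N, (fun _ _ => 0%N).
have [m [t [tE tv]]] := IH (fun v => E v /\ v q = c).
exists (n' + m)%N, (fun l => if (l < n')%N then s' l else t (l - n')%N).
split=> [l ln|v Ev].
  by case: ltnP => nl; [apply: sE' | apply: (tE _ _).1; rewrite ltn_subLR].
rewrite ltnS leq_eqVlt => /predU1P[vq|vq].
  have [l ln lv] := tv v (conj Ev vq); exists (n' + l)%N; rewrite ?ltn_add2l //.
  rewrite ltnNge leq_addr addKn /= => i.
  by rewrite ltnS leq_eqVlt => /predU1P[->|/lv//]; rewrite vq (tE l ln).2.
by have [l ln lv] := sv' v Ev vq; exists l; rewrite ?ln ?ltn_addr.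
Qed.

Section Bound.
Context {R : comPzRingType} {A : pzRingType} (phi : {rmorphism R -> A}).
Hypothesis phi_artin : artin_algebra phi.
Implicit Types K M N P Q X Y W D B C G T : lmodType A.

(** The index is shifted because positive syzygies absorb isomorphisms and projective summands,
    which makes the relation transitive. *)
Definition sim n M N := exists2 K, syz n.+1 M K & syz n.+1 N K.

Lemma sim_sym n M N : sim n M N -> sim n N M.
Proof. by move=> [K MK NK]; exists K. Qed.

Lemma sim_iso n M N : fin_gen M -> linear_iso M N -> sim n M N.
Proof.
move=> M_fg MN; have [K MK] := syz_ex phi_artin n.+1 M_fg.
by exists K => //; apply: syz_isol MN MK.
Qed.

Lemma sim_trans n M N Q : sim n M N -> sim n N Q -> sim n M Q.
Proof.
move=> [K MK NK] [K' NK' QK'].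
have [P [P' [P_fgp P'_fgp KK']]] := syz_unique (liso_refl N) NK NK'.
exists (K * P)%type; first exact: syz_absorb.
by apply: syz_isor (liso_sym KK') _; apply: syz_absorb.
Qed.

Lemma sim_prod n M N M' N' : sim n M N -> sim n M' N' ->
  sim n (M * M')%type (N * N')%type.
Proof.
by move=> [K MK NK] [K' MK' NK']; exists (K * K')%type; apply: syz_prod.
Qed.

Lemma sim_le m n M N : fin_gen M -> (m <= n)%N -> sim m M N -> sim n M N.
Proof.
move=> M_fg /subnKC <- [K MK NK].
have [K' KK'] := syz_ex phi_artin (n - m) (syz_fg phi_artin M_fg MK).
by exists K'; rewrite -addSn; apply: syz_trans KK'.
Qed.

Lemma liso_shuffle X Y D W :
  linear_iso (X * ((Y * D) * W))%type (((X * Y) * W) * D)%type.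
Proof.
apply: liso_trans (liso_prod (liso_refl X) (liso_sym (liso_prodA _ _ _))) _.
apply: liso_trans (liso_prodA _ _ _) _.
apply: liso_trans (liso_prod (liso_refl _) (liso_prodC _ _)) _.
exact: liso_prodA.
Qed.

Section Relations.
Variables (U : nat -> lmodType A) (q : nat).
Hypothesis U_fg : forall i, (i < q)%N -> fin_gen (U i).

(** A vector of length [2 q] codes a pair of modules: [low] reads its first half and [high] its
    second. *)
Definition low v := msum U v q.
Definition high v := msum U (fun i => v (q + i)%N) q.

Let low_fg v : fin_gen (low v).
Proof. exact: fg_msum. Qed.
Let high_fg v : fin_gen (high v).
Proof. exact: fg_msum. Qed.

(* Equality of [low v] and [high v] in the split Grothendieck group of some
   category of n-th syzygies. *)
Definition stably_eq v := exists D n, fin_gen D /\ sim n (low v * D)%type (high v * D)%type.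

Lemma low_sub u v : (forall i, (i < q + q)%N -> (u i <= v i)%N) ->
  linear_iso (low (fun i => v i - u i)%N * low u)%type (low v).
Proof.
move=> uv; apply: liso_trans (msum_add _ _ _ _) _; apply: msum_ext => i iq.
by rewrite subnK // uv // ltn_addr.
Qed.

Lemma high_sub u v : (forall i, (i < q + q)%N -> (u i <= v i)%N) ->
  linear_iso (high (fun i => v i - u i)%N * high u)%type (high v).
Proof.
move=> uv; apply: liso_trans (msum_add _ _ _ _) _; apply: msum_ext => i iq.
by rewrite subnK // uv // ltn_add2l.
Qed.

(** With [low u], [D'] and [D] added, the low part of the difference becomes [low v], which is
    exchanged for [high v]; then [high u] is exchanged back for [low u]. *)
Lemma stably_eq_sub u v : (forall i, (i < q + q)%N -> (u i <= v i)%N) ->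
  stably_eq u -> stably_eq v -> stably_eq (fun i => v i - u i)%N.
Proof.
move=> uv [D' [n' [D'_fg sim_u]]] [D [n [D_fg sim_v]]].
pose w i := (v i - u i)%N; pose m := maxn n' n.
have {}sim_u : sim m (low u * D')%type (high u * D')%type.
  by apply: sim_le sim_u; [apply: fg_prod | apply: leq_maxl].
have {}sim_v : sim m (low v * D)%type (high v * D)%type.
  by apply: sim_le sim_v; [apply: fg_prod | apply: leq_maxr].
exists ((low u * D') * D)%type, m; split; first by do !apply: fg_prod.
have fgX X : fin_gen X -> sim m X X by move=> X_fg; apply: (sim_iso _ X_fg (liso_refl X)).
apply: (sim_trans (N := (((low w * low u) * D) * D')%type)).
  by apply: sim_iso (liso_shuffle _ _ _ _); do !apply: fg_prod.
apply: (sim_trans (N := ((low v * D) * D')%type)).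
  apply: sim_iso; first by do !apply: fg_prod.
  by do 2 (apply: liso_prod; last exact: liso_refl); apply: low_sub.
apply: (sim_trans (N := ((high v * D) * D')%type)).
  by apply: sim_prod => //; apply: fgX.
apply: (sim_trans (N := ((high w * ((high u * D') * D)))%type)).
  apply: sim_iso; first by do !apply: fg_prod.
  apply: liso_sym; apply: liso_trans (liso_shuffle _ _ _ _) _.
  by do 2 (apply: liso_prod; last exact: liso_refl); apply: high_sub.
apply: sim_prod; first exact: fgX.
by apply: sim_prod; [apply: sim_sym | apply: fgX].
Qed.

(** Repeated subtraction reduces each relation to finitely many generators [s l]. Hence one level
    [j] serves all relations, and [K] is a sum of copies of the syzygies chosen for the [s l], a
    summand of a power of their direct sum. *)
Lemma stably_eq_uniform : exists j T, fin_gen T /\ forall v, stably_eq v ->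
  exists D K c, [/\ syz j.+1 (low v * D)%type K, syz j.+1 (high v * D)%type K,
    fin_gen D & retract K (dsum (fun=> T) c)].
Proof.
(* Excluding the zero vector makes each subtraction lower the sum of the coordinates. *)
have [n [s [sE sv]]] := dickson (q + q)
  (fun v => stably_eq v /\ (0 < \sum_(i < q + q) v i)%N).
have /choice[D /choice[m DmE]] : forall l, exists D m, (l < n)%N ->
    fin_gen D /\ sim m (low (s l) * D)%type (high (s l) * D)%type.
  move=> l; have [ln|_] := ltnP l n; last by exists 'rV[A]_0, 0%N.
  by have [[D [m Dm]] _] := sE l ln; exists D, m.
pose j := \max_(l < n) m l.
have /choice[K KE] : forall l, exists K, (l < n)%N ->
    syz j.+1 (low (s l) * D l)%type K /\ syz j.+1 (high (s l) * D l)%type K.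
  move=> l; have [ln|_] := ltnP l n; last by exists 'rV[A]_0.
  have [D_fg Dm] := DmE l ln.
  have [||K ? ?] := sim_le (n := j) _ _ Dm.
  - exact: fg_prod.
  - by apply: (leq_bigmax (Ordinal ln)).
  by exists K.
exists j, (dsum K n); split.
  apply: fg_dsum => l ln; apply: (syz_fg phi_artin) (KE l ln).1.
  by apply: fg_prod => //; case: (DmE l ln).
move=> v; have [k] := ubnP (\sum_(i < q + q) v i)%N.
elim: k v => // k IH v vk v_eq.
have [v0|v_gt0] := posnP (\sum_(i < q + q) v i)%N.
  have {}v0 i : (i < q + q)%N -> v i = 0%N.
    move=> iq; apply/eqP; rewrite -leqn0 -v0.
    by rewrite (bigD1 (Ordinal iq)) //= leq_addr.
  have Z M : zero_mod M -> syz j.+1 (M * 'rV[A]_0)%type 'rV[A]_0.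
    move=> M0; apply: syz_isol (syz_fgp _ (fgp_rV 0)).
    apply: liso_sym; apply: liso_trans (liso_prodC _ _) _; exact: liso_prodr0.
  exists 'rV[A]_0, 'rV[A]_0, 0%N; split.
  - by apply/Z/msum0 => i iq; rewrite v0 // ltn_addr.
  - by apply/Z/msum0 => i iq; rewrite v0 // ltn_add2l.
  - exact: fg_rV.
  - exact: retract_refl.
have [l ln uv] := sv v (conj v_eq v_gt0); have [u_eq u_gt0] := sE l ln.
set u := s l in uv u_eq u_gt0; pose w i := (v i - u i)%N.
have sum_w : (\sum_(i < q + q) w i + \sum_(i < q + q) u i = \sum_(i < q + q) v i)%N.
  by rewrite -big_split /=; apply: eq_bigr => i _; rewrite /w subnK // uv.
have [||D1 [K1 [c [low1 high1 D1_fg K1T]]]] := IH w.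
- by move: vk; rewrite -sum_w ltnS; apply: leq_trans; rewrite -addn1 leq_add2l.
- exact: stably_eq_sub.
have [lowl highl] := KE l ln.
exists (D1 * D l)%type, (K1 * K l)%type, c.+1; split.
- apply: syz_isol (syz_prod low1 lowl).
  apply: liso_trans (liso_prodACA _ _ _ _) _.
  by apply: liso_prod (liso_refl _); apply: low_sub.
- apply: syz_isol (syz_prod high1 highl).
  apply: liso_trans (liso_prodACA _ _ _ _) _.
  by apply: liso_prod (liso_refl _); apply: high_sub.
- by apply: fg_prod => //; case: (DmE l ln).
- by apply: retract_prod K1T _; apply: dsum_retract.
Qed.

End Relations.

(* On the part of [C] where the component [f : C -> C] of [i] is nilpotent,
   the identity dies in high syzygies, since [f] becomes invertible there; the
   complementary part cancels from the sequence. *)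
Lemma nilpotent_bound n r C P X (i : {linear C -> (C * P)%type})
    (p : {linear (C * P)%type -> X}) : fin_gen C -> fgp P -> short_exact i p ->
  bounded n C C -> stable0 r (lid X) -> stable0 n.+1 (lid X).
Proof.
move=> C_fg P_fgp ip bd X0; have [i_inj pi pK p_onto] := (short_exactP _ _).1 ip.
have X_fg : fin_gen X by apply: fg_onto p_onto _; apply: fg_prod => //; case: P_fgp.
pose f := lcomp (lfst C P) i.
have [k /(_ k.+1 (leqnSn k)) f_fit] := fitting phi_artin f C_fg.
have [N [a [b [_ [ab _ aE bE]]]]] := fit_split f_fit.
set g := liter k.+1 f in f_fit aE bE.
(* [C2] is the Fitting summand on which [f] is nilpotent. *)
have [C2 [d [d_inj dE]]] := submod_ex (ker_submod g).
have gd x : g (d x) = 0 by apply/dE; exists x.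
have ker_f x : (exists y, d y = f x) <-> (exists y, d y = x).
  have gf : g (f x) = f (g x) by rewrite -[LHS]/(iter k.+1 f (f x)) -iterSr.
  rewrite -!dE gf; split=> [fgx|->]; last exact: linear0.
  apply: f_fit.1; rewrite -[LHS]/(iter k.+1 f (g x)) iterSr fgx.
  exact: (linear0 (liter k f)).
have /(linear_lift d_inj)[f2 f2E] : forall x, exists y, d y = lcomp f d x.
  by move=> x; apply/ker_f; exists x.
have C2_ret : retract C2 C.
  have /(linear_lift d_inj)[r2 r2E] : forall x, exists y,
      d y = ladd (lid C) (lopp (lcomp a b)) x.
    by move=> x; apply/dE/bE; rewrite linearB /= ab subrr.
  exists d, r2 => x; apply: d_inj; rewrite r2E /=.
  by rewrite (bE (d x)).2 // linear0 subr0.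
have C2_fg := fg_retract C2_ret C_fg.
pose i2 := lpair f2 (lcomp (lsnd C P) (lcomp i d)); pose p2 := lcomp p (lprod d (lid P)).
have i2E x : lprod d (lid P) (i2 x) = i (d x).
  by rewrite [RHS]surjective_pairing /= f2E.
have ip2 : short_exact i2 p2.
  apply/short_exactP; split=> [x y xy|x|[y z] /= /pK[x xE]|x].
  - by apply/d_inj/i_inj; rewrite -!i2E xy.
  - by rewrite -[p2 _]/(p (lprod d (lid P) (i2 x))) i2E pi.
  - have [w wE] : exists w, d w = x by apply/ker_f; exists y; rewrite /= xE.
    exists w; have := i2E w; rewrite wE xE => -[/d_inj <- <-].
    by rewrite /= wE xE.
  - have [[y z] <-] := p_onto x.
    have [w wE] : exists w, g w = a (b y) by apply/aE; exists (b y).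
    have [y2 y2E] : exists y2, d y2 = y - a (b y).
      by apply/dE/bE; rewrite linearB /= ab subrr.
    (* Here [f c = a (b y)], so subtracting [i c] removes the part of [y] outside [C2]. *)
    pose c := liter k f w.
    exists (y2, z - (i c).2).
    have -> : p2 (y2, z - (i c).2) = p ((y, z) - i c).
      rewrite [i c in RHS]surjective_pairing -[(i c).1 in RHS]/(g w) wE.
      by rewrite -[RHS]/(p (y - a (b y), z - (i c).2)) -y2E.
    by rewrite linearB pi subr0.
have [C' [G' [X' [i' [p' [ip' G'_fgp XX' ff']]]]]] :=
  seq_endo_syz phi_artin r C2_fg ip2 P_fgp.
set f' := lcomp (lfst C' G') i' in ff'.
have C'_fg : fin_gen C' := syz_fg phi_artin C2_fg (endo_syz_syz ff').
(* As [X'] is projective, the sequence splits, and the splitting gives [f'] a right inverse [h]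
   modulo maps through projectives. *)
have X'_proj : projective X'.
  by apply: stable0_id0; apply: (syz_stable0_inv phi_artin X_fg XX'); rewrite addn0.
have [i'_inj _ pK' p'_onto] := (short_exactP _ _).1 ip'.
have [t tE] := proj_lift (lid X') X'_proj p'_onto.
have /(linear_lift i'_inj)[s sE] : forall x, exists y,
    i' y = ladd (lid _) (lopp (lcomp t p')) x.
  by move=> x; apply: pK'; rewrite linearB /= tE subrr.
pose h := lcomp s (linl C' G').
have fhE x : f' (h x) = x - (t (p' (x, 0))).1.
  by rewrite -[LHS]/(i' (s (x, 0))).1 sE.
have inv m : exists u, stable0 0 (ladd (lid C') (lopp (lcomp (liter m f') u))).
  elim: m => [|m [u [Q [v [v' [Q_proj uE]]]]]].
    exists (lid C'), X', (lzero _ _), (lzero _ _); split=> // x.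
    exact: subrr.
  exists (lcomp h u), (Q * X')%type, (lpair v (lcomp p' (lcomp (linl C' G') u))).
  exists (lcopair v' (lcomp (liter m f') (lcomp (lfst C' G') t))).
  split=> [|x]; first exact: proj_prod.
  rewrite -[RHS]/(v' (v x) + iter m f' (t (p' (u x, 0))).1) -uE.
  rewrite -[LHS]/(x - iter m.+1 f' (h (u x))) iterSr fhE.
  rewrite -[iter m f' (_ - _)]/(liter m f' (_ - _)) linearB opprD opprK addrA.
  by [].
have [u u0] := inv k.+1.
(* Nilpotency of [f2] makes a power of [f'] factor through a projective; together with [inv] this
   kills the identity of [C']. *)
have f'0 : stable0 0 (liter k.+1 f').
  apply: (endo_syz_stable0_inv phi_artin (endo_syz_iter k.+1 ff') C2_fg).
  apply: stable0_ext (stable0_zero phi_artin (r + 0) C2_fg C2_fg) => x.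
  apply: d_inj; rewrite linear0 -(gd x) /g -![liter _ _ _]/(iter _ _ _).
  by elim: (k.+1) => //= m ->; rewrite f2E.
have C'0 : stable0 0 (lid C').
  have := stable0_add phi_artin C'_fg C'_fg u0
    (stable0_compl phi_artin u C'_fg C'_fg f'0).
  by apply: stable0_ext => x; apply: subrK.
have C20 : stable0 n (lid C2).
  apply: (bounded_retract phi_artin C_fg C_fg C2_ret C2_ret bd (m := r + 0)).
  exact: syz_stable0 (endo_syz_syz ff') C'0.
(* The n-th syzygy [K] of [C2] is now projective, so the n-th syzygy [X2] of [X] has a projective
   resolution of length 1. *)
have [K C2K] := syz_ex phi_artin n C2_fg.
have K_fg := syz_fg phi_artin C2_fg C2K.
have K_proj : projective K.
  by apply: stable0_id0; apply: (syz_stable0_inv phi_artin C2_fg C2K); rewrite addn0.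
have [G2 [X2 [i3 [p3 [ip3 G2_fgp XX2]]]]] := seq_syz ip2 P_fgp C2K C2K.
have cov3 : pcover i3 p3 by split=> //; apply: fgp_prod.
rewrite -addn1; apply: (syz_stable0 XX2).
apply: (stable0_mk cov3 cov3 (over_id i3 p3)).
exact: (stable0_id_proj phi_artin).
Qed.

Lemma sum_bound (U : nat -> lmodType A) q :
  (forall i, (i < q)%N -> fin_gen (U i)) ->
  exists c, forall B0 B1 W v w r (i : {linear B0 -> B1}) (p : {linear B1 -> W}),
    short_exact i p -> linear_iso B0 (msum U v q) -> linear_iso B1 (msum U w q) ->
    stable0 r (lid W) -> stable0 c (lid W).
Proof.
move=> U_fg; have [j [T [T_fg uni]]] := stably_eq_uniform U_fg.
have [n bd] := bounded_ex phi_artin T_fg T_fg.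
(* [j.+1] syzygies make both terms agree up to a projective; [nilpotent_bound] adds [n.+1]. *)
exists (j.+1 + n.+1)%N => B0 B1 W v w r i p ip B0v B1w W0.
have Z_fgp : fgp 'rV[A]_0 := fgp_rV 0.
have B0_fg : fin_gen B0 by apply: fg_iso B0v _; apply: fg_msum.
have B1_fg : fin_gen B1 by apply: fg_iso B1w _; apply: fg_msum.
have [i_inj pi pK p_onto] := (short_exactP _ _).1 ip.
have W_fg := fg_onto p_onto B1_fg.
pose vw k := if (k < q)%N then v k else w (k - q)%N.
have B0_low : linear_iso B0 (low U q vw).
  by apply: liso_trans B0v _; apply: msum_ext => k kq; rewrite /vw kq.
have B1_high : linear_iso B1 (high U q vw).
  by apply: liso_trans B1w _; apply: msum_ext => k _; rewrite /vw ltnNge leq_addr addKn.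
pose i0 := lcomp (linl B1 'rV[A]_0) i; pose p0 := lcomp p (lfst B1 'rV[A]_0).
have ip0 : short_exact i0 p0.
  apply/short_exactP; split=> [x y /= [/i_inj//]|x|[y z] /= /pK[x xE]|x].
  - by rewrite /= pi.
  - by exists x; rewrite /= xE (zero_rV0 z).
  - by have [y <-] := p_onto x; exists (y, 0).
(* Past the projective dimension of [W] the sequence of syzygies splits, so [B0] and [B1] get a
   common syzygy up to projectives. *)
have vw_eq : stably_eq U q vw.
  have [K0 B0K] := syz_ex phi_artin r.+1 B0_fg.
  have [K1 B1K] := syz_ex phi_artin r.+1 B1_fg.
  have [G [X [i1 [p1 [ip1 G_fgp WX]]]]] := seq_syz ip0 Z_fgp B0K B1K.
  have X_proj : projective X.
    apply: stable0_id0; apply: (syz_stable0_inv phi_artin W_fg WX).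
    by rewrite addn0; apply: (stable0S phi_artin).
  have X_fgp : fgp X by split=> //; apply: (syz_fg phi_artin W_fg WX).
  have B01 : sim r B0 B1.
    exists (K0 * X)%type; first exact: syz_absorb.
    by apply: syz_isor (proj_split X_proj ip1) _; apply: syz_absorb.
  exists 'rV[A]_0, r; split; first exact: fg_rV.
  apply: sim_prod; last exact: sim_iso (fg_rV 0) (liso_refl _).
  apply: sim_trans (sim_iso _ _ (liso_sym B0_low)) _; first exact: fg_msum.
  exact: sim_trans B01 (sim_iso _ B1_fg B1_high).
have [D [K [c [lowK highK D_fg KT]]]] := uni vw vw_eq.
pose i2 := lcomp (linl (B1 * D)%type 'rV[A]_0) (lprod i (lid D)).
pose p2 := lcomp p (lcomp (lfst B1 D) (lfst (B1 * D)%type 'rV[A]_0)).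
have ip2 : short_exact i2 p2.
  apply/short_exactP.
  split=> [[x d] [x' d'] /= [/i_inj -> ->]//|[x d]|[[y d] z] /= /pK[x xE]|x].
  - by rewrite /= pi.
  - by exists (x, d); rewrite /= xE (zero_rV0 z).
  - by have [y <-] := p_onto x; exists ((y, 0), 0).
have {}lowK : syz j.+1 (B0 * D)%type K.
  by apply: syz_isol lowK; apply: liso_prod (liso_sym B0_low) (liso_refl D).
have {}highK : syz j.+1 (B1 * D)%type K.
  by apply: syz_isol highK; apply: liso_prod (liso_sym B1_high) (liso_refl D).
have [G [X [i3 [p3 [ip3 G_fgp WX]]]]] := seq_syz ip2 Z_fgp lowK highK.
have T_fg' : fin_gen (dsum (fun=> T) c) by apply: fg_dsum.
have K_fg := fg_retract KT T_fg'.
apply: (syz_stable0 WX).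
apply: (nilpotent_bound (r := r) K_fg G_fgp ip3).
  by apply: (bounded_retract phi_artin T_fg' T_fg' KT KT); apply: (bounded_dsum phi_artin).
apply: (syz_stable0_inv phi_artin W_fg WX).
by apply: (stable0_le phi_artin) W0 => //; apply: leq_addl.
Qed.

End Bound.

(** * Summands of extensions *)

Section ExtensionBound.
Context {R : comPzRingType} {A : pzRingType} (phi : {rmorphism R -> A}).
Hypothesis phi_artin : artin_algebra phi.
Implicit Types K M N P Q X Y W D B C G T : lmodType A.

Lemma rV_dsum m : linear_iso 'rV[A]_m (dsum (fun=> 'rV[A]_1) m).
Proof.
elim: m => [|m IH]; first exact: liso_refl.
apply: (liso_trans (N := ('rV[A]_m * 'rV[A]_1)%type)); last exact: liso_prod IH (liso_refl _).
apply: (@liso_bij _ 'rV[A]_(1 + m) _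
  (lpair (rsubmx : {linear 'rV[A]_(1 + m) -> 'rV[A]_m})
         (lsubmx : {linear 'rV[A]_(1 + m) -> 'rV[A]_1}))).
  by move=> x y [xyr xyl]; rewrite -(hsubmxK x) -(hsubmxK y) xyl xyr.
by move=> [x y]; exists (row_mx y x); rewrite /= row_mxKl row_mxKr.
Qed.

Lemma fgp_retract_dsum G : fgp G -> exists m, retract G (dsum (fun=> 'rV[A]_1) m).
Proof.
move=> [G_proj /fg_free[m [g g_onto]]]; exists m.
have [s sE] := proj_lift (lid G) G_proj g_onto.
apply: (retract_trans (N := 'rV[A]_m)); first by exists s, g.
exact/retract_iso/rV_dsum.
Qed.

Lemma cover_dsum K P M (f : {linear K -> P}) (g : {linear P -> M}) n : pcover f g ->
  exists (f' : {linear dsum (fun=> K) n -> dsum (fun=> P) n})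
    (g' : {linear dsum (fun=> P) n -> dsum (fun=> M) n}), pcover f' g'.
Proof.
move=> fg; elim: n => [|n [f' [g' fg']]] /=.
  by exists (lzero _ _), (lid _); apply: cover_id; apply: fgp_rV.
by exists (lprod f' f), (lprod g' g); apply: cover_prod.
Qed.

Lemma iter_comm (S T : Type) (p : S -> T) (b : S -> S) (e : T -> T) n :
  (forall x, p (b x) = e (p x)) -> forall x, p (iter n b x) = iter n e (p x).
Proof. by move=> pb x; elim: n => //= n <-. Qed.

(** The sequence restricts to the images of [a], [b] and [e]. Exactness in the middle holds because
    the kernel and the image of [b] meet in 0. *)
Lemma fit_exact D B X (i : {linear D -> B}) (p : {linear B -> X})
    (a : {linear D -> D}) (b : {linear B -> B}) (e : {linear X -> X})
    D' B' X'
    (iD : {linear D' -> D}) (rD sD : {linear D -> D'})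
    (iB : {linear B' -> B}) (rB sB : {linear B -> B'})
    (iX : {linear X' -> X}) (rX sX : {linear X -> X'}) :
  short_exact i p -> (forall x, i (a x) = b (i x)) -> (forall x, p (b x) = e (p x)) ->
  fit b ->
  [/\ cancel iD rD, forall x, sD (a (iD x)) = x,
    forall y, (exists x, iD x = y) <-> (exists z, a z = y)
    & forall x, rD x = 0 <-> a x = 0] ->
  [/\ cancel iB rB, forall x, sB (b (iB x)) = x :> B',
    forall y, (exists x, iB x = y) <-> (exists z, b z = y)
    & forall x, rB x = 0 <-> b x = 0] ->
  [/\ cancel iX rX, forall x, sX (e (iX x)) = x :> X',
    forall y, (exists x, iX x = y) <-> (exists z, e z = y)
    & forall x, rX x = 0 <-> e x = 0] ->
  exists (i' : {linear D' -> B'}) (p' : {linear B' -> X'}), short_exact i' p'.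
Proof.
move=> /short_exactP[i_inj pi pK p_onto] ia pb b_fit.
move=> [iDK _ aE rDE] [iBK _ bE _] [iXK _ eE _].
have /(linear_lift (can_inj iBK))[i' i'E] : forall x, exists y, iB y = lcomp i iD x.
  move=> x; apply/bE; have [z zE] : exists z, a z = iD x by apply/aE; exists x.
  by exists (i z); rewrite -ia zE.
have /(linear_lift (can_inj iXK))[p' p'E] : forall x, exists y, iX y = lcomp p iB x.
  move=> x; apply/eE; have [z zE] : exists z, b z = iB x by apply/bE; exists x.
  by exists (p z); rewrite -pb zE.
exists i', p'; apply/short_exactP; split=> [x y xy|x|y y0|x].
- by apply/(can_inj iDK)/i_inj; rewrite -[LHS]/(lcomp i iD x) -i'E xy i'E.
- by apply: (can_inj iXK); rewrite p'E /= i'E /= pi linear0.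
- have [x xE] : exists x, i x = iB y by apply: pK; rewrite -[LHS]p'E y0 linear0.
  exists (rD x); apply: (can_inj iBK); rewrite i'E /= -xE.
  apply/eqP; rewrite eq_sym -subr_eq0 -linearB; apply/eqP.
  set d := x - _.
  have ad : a d = 0 by apply/rDE; rewrite linearB iDK subrr.
  have [z zE] : exists z, b z = i d.
    have [u uE] : exists u, b u = iB y by apply/bE; exists y.
    have [w wE] : exists w, a w = iD (rD x) by apply/aE; exists (rD x).
    by exists (u - i w); rewrite linearB uE -ia wE /d linearB xE.
  by rewrite -zE; apply: b_fit.1; rewrite zE -ia ad linear0.
have [z zE] : exists z, e z = iX x by apply/eE; exists x.
have [y yE] := p_onto z.
have [w wE] : exists w, iB w = b y by apply/bE; exists y.
by exists w; apply: (can_inj iXK); rewrite p'E /= wE pb yE.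
Qed.

(* Since [e] lifts to the sequence, its Fitting decomposition does too, and the
   image of a power of [e] is itself the cokernel of a map between summands of
   fixed modules. *)
Lemma endo_bound S0 S1 : fin_gen S0 -> fin_gen S1 ->
  exists c, forall a b G X (i : {linear dsum (fun=> S1) b -> (dsum (fun=> S0) a * G)%type})
      (p : {linear (dsum (fun=> S0) a * G)%type -> X}) (e : {linear X -> X})
      (t : {linear (dsum (fun=> S0) a * G)%type -> (dsum (fun=> S0) a * G)%type}),
    short_exact i p -> fgp G -> (forall x, p (t x) = e (p x)) ->
    forall r, (forall n, (0 < n)%N -> stable0 r (liter n e)) ->
    exists2 n, (0 < n)%N & stable0 c (liter n e).
Proof.
(* The free summand of [S] accounts for [G], which is a summand of a free module of unbounded
   rank. *)
move=> S0_fg S1_fg; pose S := ((S0 * S1) * 'rV[A]_1)%type.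
have S_fg : fin_gen S by do !apply: fg_prod => //; apply: fg_rV.
have [q [U [U_ind SU]]] := decomposition phi_artin S_fg.
have [|c cP] := sum_bound phi_artin (U := U) (q := q).
  by move=> i iq; apply: (U_ind i iq).2.
exists c => a b G X i p e t ip G_fgp pt r e0.
set D := dsum _ b in i ip; set B := (_ * G)%type in i p t ip pt.
have D_fg : fin_gen D by apply: fg_dsum.
have B_fg : fin_gen B by apply: fg_prod; [apply: fg_dsum | case: G_fgp].
have [i_inj pi pK p_onto] := (short_exactP _ _).1 ip.
have X_fg := fg_onto p_onto B_fg.
have /(linear_lift i_inj)[d dE] : forall x, exists y, i y = lcomp t i x.
  by move=> x; apply: pK; rewrite /= pt pi linear0.
have [nd ndP] := fitting phi_artin d D_fg.
have [nt ntP] := fitting phi_artin t B_fg.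
have [ne neP] := fitting phi_artin e X_fg.
(* Large enough for all three Fitting decompositions, and positive because the hypothesis on [e]
   concerns positive powers only. *)
pose n := (nd + nt + ne).+1.
have d_fit : fit (liter n d) by apply: ndP; apply: leqW; rewrite -addnA leq_addr.
have t_fit : fit (liter n t) by apply: ntP; apply: leqW; rewrite addnAC leq_addl.
have e_fit : fit (liter n e) by apply: neP; apply/leqW/leq_addl.
have [D' [iD [rD [sD dsplit]]]] := fit_split d_fit.
have [B' [iB [rB [sB tsplit]]]] := fit_split t_fit.
have [W [iW [rW [sW esplit]]]] := fit_split e_fit.
have [i' [p' ip']] : exists (i' : {linear D' -> B'}) (p' : {linear B' -> W}),
    short_exact i' p'.
  apply: (fit_exact ip _ _ t_fit dsplit tsplit esplit).
    exact: (iter_comm (p := i)).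
  exact: (iter_comm (p := p)).
have W_ret : retract W X by exists iW, rW; case: esplit.
have W_fg := fg_retract W_ret X_fg.
have [m GS] := fgp_retract_dsum G_fgp.
have S0S : retract S0 S by apply: retract_trans (retractl _ _) (retractl _ _).
have S1S : retract S1 S by apply: retract_trans (retractr _ _) (retractl _ _).
have D'_ret : retract D' (dsum (fun=> S) b).
  apply: (retract_trans (N := D)); first by exists iD, rD; case: dsplit.
  by apply: dsum_retract2.
have B'_ret : retract B' (dsum (fun=> S) (a + m)).
  apply: (retract_trans (N := B)); first by exists iB, rB; case: tsplit.
  apply: retract_trans (retract_iso (dsum_const_add _ _ _)).
  apply: retract_prod; first by apply: dsum_retract2.
  by apply: retract_trans GS _; apply: dsum_retract2 => _ _; apply: retractr.
have D'_fg : fin_gen D' by apply: fg_retract D'_ret _; apply: fg_dsum.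
have B'_fg : fin_gen B' by apply: fg_retract B'_ret _; apply: fg_dsum.
have [v D'v] := retract_msum phi_artin D'_fg U_ind SU D'_ret.
have [w B'w] := retract_msum phi_artin B'_fg U_ind SU B'_ret.
have [iWK sWE eWE _] := esplit.
have W0 : stable0 r (lid W).
  have := stable0_comp phi_artin iW sW W_fg W_fg (e0 n isT).
  by apply: stable0_ext => x; apply: sWE.
have {}W0 := cP _ _ _ _ _ _ _ _ ip' D'v B'w W0.
exists n => //.
have /(linear_lift (can_inj iWK))[k kE] : forall x, exists y, iW y = liter n e x.
  by move=> x; apply/eWE; exists x.
have := stable0_comp phi_artin k iW X_fg X_fg W0.
by apply: stable0_ext => x; rewrite -kE.
Qed.

Lemma ext_bound T : fin_gen T -> exists c,
  forall a b X (i : {linear dsum (fun=> T) a -> X})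
    (p : {linear X -> dsum (fun=> T) b}) (e : {linear X -> X}) r,
  short_exact i p -> (forall x, e (e x) = e x) -> stable0 r e -> stable0 c e.
Proof.
move=> T_fg; have [T1 [F [f [g fg]]]] := cover_ex T_fg.
have T1_fg := cover_fg phi_artin fg.
have [n bd] := bounded_ex phi_artin T1_fg T1_fg.
have [S0 TS0] := syz_ex phi_artin n.+1 T_fg.
have [S1 TS1] := syz_ex phi_artin n.+1 T1_fg.
have [c cP] := endo_bound (syz_fg phi_artin T_fg TS0) (syz_fg phi_artin T1_fg TS1).
(* [n.+1] syzygies remove the obstruction, and [c] comes from [endo_bound]. *)
exists (n.+1 + c)%N => a b X i p e r ip ee e0.
set B := dsum _ a in i ip.
have B_fg : fin_gen B by apply: fg_dsum.
have [i_inj pi pK p_onto] := (short_exactP _ _).1 ip.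
have [fb [gb fgb]] := cover_dsum b fg; have [fa [ga fga]] := cover_dsum a fg.
have [fb_inj gfb gKb gb_onto] := coverP fgb.
set D := dsum _ b in fb fgb fb_inj gfb gKb.
set G := dsum (fun=> F) b in fb gb fgb fb_inj gfb gKb gb_onto.
(* Lifting the cover of the quotient along [p] presents [X] as [B * G] modulo [D], a power of the
   syzygy [T1]. *)
have [h hE] := proj_lift gb fgb.1.1 p_onto.
have /(linear_lift i_inj)[m mE] : forall x, exists y, i y = lcomp h fb x.
  by move=> x; apply: pK; rewrite /= hE gfb.
pose i1 := lpair (lopp m) fb; pose p1 := lcopair i h.
have ip1 : short_exact i1 p1.
  apply/short_exactP; split=> [x y [_ /fb_inj]//|x|[y u] yu|x].
  - by rewrite /= linearN mE addNr.
  - have /gKb[x xE] : gb u = 0.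
      by rewrite -hE -[h u](addKr (i y)) -[i y + h u]/(p1 (y, u)) yu addr0 linearN pi oppr0.
    exists x; rewrite /= xE; congr pair; apply: i_inj; rewrite linearN mE /= xE.
    by apply/eqP; rewrite eq_sym -addr_eq0; apply/eqP.
  - have [u uE] := gb_onto (p x).
    have [y yE] : exists y, i y = x - h u by apply: pK; rewrite linearB hE uE subrr.
    by exists (y, u); rewrite /= yE subrK.
have D_fg : fin_gen D by apply: fg_dsum.
have BG_fg : fin_gen (B * G)%type by apply: fg_prod => //; case: fgb => -[].
have [_ _ _ p1_onto] := (short_exactP _ _).1 ip1.
have X_fg := fg_onto p1_onto BG_fg.
have ob : obstr n i1 p1 e.
  have fgaG := cover_extend fga fgb.1.
  have [t [w tw]] := over_ex (lcomp e p1) fgaG ip1.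
  apply: (obstr_indep phi_artin D_fg ip1 fgaG tw).
  have w0 : stable0 r w.
    have e0' := stable0S phi_artin X_fg X_fg e0.
    exact: (obstr_stable0 phi_artin D_fg BG_fg X_fg ip1 e0' fgaG tw).
  have Ta_fg : fin_gen (dsum (fun=> T1) a) by apply: fg_dsum.
  have wl0 := stable0_compl phi_artin (linl _ _) Ta_fg D_fg w0.
  have := bounded_dsum phi_artin T1_fg T1_fg bd wl0.
  move=> /(stable0_compl phi_artin (lfst _ _) (cover_fg phi_artin fgaG) D_fg).
  by apply: stable0_ext => -[x z] /=; rewrite (zero_rV0 z).
have DK : syz n.+1 D (dsum (fun=> S1) b) by apply: syz_dsum.
have BK : syz n.+1 B (dsum (fun=> S0) a) by apply: syz_dsum.
have [G' [X' [i' [p' [e' [t [ip' G'_fgp ee' tE]]]]]]] :=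
  seq_lift phi_artin D_fg B_fg ip1 fgb.1 DK BK ob.
(* The lift [e'] need not be idempotent, but all its positive powers lie over [e]. *)
have liter_e k : (0 < k)%N -> liter k e =1 e.
  by case: k => // k _ x /=; elim: k => //= k ->.
have [|k k_gt0 k0] := cP a b G' X' i' p' e' t ip' G'_fgp tE r.
  move=> k k_gt0; apply: (endo_syz_stable0_inv phi_artin (endo_syz_iter k ee') X_fg).
  apply: (stable0_le phi_artin X_fg X_fg (leq_addl n.+1 r)).
  by apply: stable0_ext e0 => x; rewrite liter_e.
have := endo_syz_stable0 (endo_syz_iter k ee') k0.
by apply: stable0_ext => x; rewrite liter_e.
Qed.

End ExtensionBound.

(** * Projective dimension and layers *)

Lemma inf_nat_lty (S : set nat) : (inf_nat S < +oo)%E <-> exists n, S n.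
Proof.
rewrite /inf_nat; case: pselect => [ex|nex].
  by split=> _; [case: ex => n /asboolP Sn; exists n | apply: ltry].
by split=> // -[n Sn]; case: nex; exists n; apply/asboolP.
Qed.

Lemma inf_nat_le (S : set nat) k :
  (inf_nat S <= k%:Z%:E)%E <-> exists2 n, (n <= k)%N & S n.
Proof.
rewrite /inf_nat; case: pselect => [ex|nex].
  case: ex_minnP => m /asboolP Sm m_min; rewrite lee_fin lez_nat.
  split=> [mk|[n nk Sn]]; first by exists m.
  by apply: leq_trans nk; apply/m_min/asboolP.
by split=> // -[n _ Sn]; case: nex; exists n; apply/asboolP.
Qed.

Section ProjectiveDimension.
Context {A : pzRingType}.
Implicit Types K M N P X Z : lmodType A.

Lemma pr_iso n M N : linear_iso M N -> proj_resolution n M -> proj_resolution n N.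
Proof.
move=> MN; case: n => [|n] /=; first exact/proj_retract/retract_iso/liso_sym.
move=> [P [K [f [g [P_proj fg K_res]]]]]; have [h [h' [hK hK']]] := liso_ex MN.
exists P, K, f, (lcomp h g); split=> //.
have [f_inj gf gK g_onto] := (short_exactP _ _).1 fg.
apply/short_exactP; split=> // [x|y|y] /=.
- by rewrite gf linear0.
- by rewrite -(linear0 h) => /(can_inj hK)/gK.
- by have [x xE] := g_onto (h' y); exists x; rewrite xE hK'.
Qed.

Lemma pr_leS n M : proj_resolution n M -> proj_resolution n.+1 M.
Proof.
elim: n M => [|n IH] M.
  move=> M_proj; exists M, 'rV[A]_0, (lzero _ _), (lid M); split=> //.
    apply/short_exactP; split=> // [x y _|y /= ->|y]; last by exists y.
      by rewrite (zero_rV0 x) (zero_rV0 y).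
    by exists 0.
  exact: proj_free.
move=> [P [K [f [g [P_proj fg K_res]]]]].
by exists P, K, f, g; split=> //; apply: IH.
Qed.

Lemma pr_le m n M : (m <= n)%N -> proj_resolution m M -> proj_resolution n M.
Proof.
move=> /subnKC <- M_res; elim: (n - m)%N => [|k IH]; first by rewrite addn0.
by rewrite addnS; apply: pr_leS.
Qed.

Lemma pr_add n M Q : projective Q -> proj_resolution n M ->
  proj_resolution n (M * Q)%type.
Proof.
move=> Q_proj; case: n => [|n]; first by move=> M_proj; apply: proj_prod.
move=> [P [K [f [g [P_proj fg K_res]]]]].
have [f_inj gf gK g_onto] := (short_exactP _ _).1 fg.
exists (P * Q)%type, K, (lcomp (linl P Q) f), (lprod g (lid Q)).
split=> //; first exact: proj_prod.
apply/short_exactP; split=> [x y [/f_inj]//|x|[y z] /= [/gK[x <-] ->]|[x z]] /=.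
- by rewrite gf.
- by exists x.
- by have [y <-] := g_onto x; exists (y, z).
Qed.

(** The kernel [X] of the composite from [P] to [M] is an extension of [Q] by [K], hence isomorphic
    to [K * Q]. *)
Lemma pr_summand n M Q : projective Q -> proj_resolution n (M * Q)%type ->
  proj_resolution n M.
Proof.
move=> Q_proj; case: n => [|n] /=; first exact/proj_retract/retractl.
move=> [P [K [f [g [P_proj fg K_res]]]]].
have [f_inj gf gK g_onto] := (short_exactP _ _).1 fg.
have g1_onto : onto (lcomp (lfst M Q) g).
  by move=> x; have [y yE] := g_onto (x, 0); exists y; rewrite /= yE.
have [X [j jg]] := ker_ex g1_onto.
have [j_inj gj jK _] := (short_exactP _ _).1 jg.
exists P, X, j, (lcomp (lfst M Q) g); split=> //.
have /(linear_lift j_inj)[k kE] : forall x, exists y, j y = f x.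
  by move=> x; apply: jK; rewrite /= gf.
have kg : short_exact k (lcomp (lsnd M Q) (lcomp g j)).
  apply/short_exactP; split=> [x y /(congr1 j)|x|y gy|z].
  - by rewrite !kE => /f_inj.
  - by rewrite /= kE gf.
  - have /gK[x xE] : g (j y) = 0.
      rewrite [LHS]surjective_pairing -[(g _).1]/(lcomp (lfst M Q) g (j y)) gj.
      by rewrite -[(g _).2]/(lcomp (lsnd M Q) (lcomp g j) y) gy.
    by exists x; apply: j_inj; rewrite kE.
  - have [y yE] := g_onto (0, z); have [x xE] : exists x, j x = y by apply: jK; rewrite /= yE.
    by exists x; rewrite /= xE yE.
exact: pr_iso (liso_sym (proj_split Q_proj kg)) (pr_add Q_proj K_res).
Qed.

Lemma pr_ker n K P M (f : {linear K -> P}) (g : {linear P -> M}) :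
  projective P -> short_exact f g -> proj_resolution n.+1 M -> proj_resolution n K.
Proof.
move=> P_proj fg [P' [K' [f' [g' [P'_proj fg' K'_res]]]]].
apply: (pr_summand P'_proj).
exact: pr_iso (schanuel fg' fg P'_proj P_proj) (pr_add P_proj K'_res).
Qed.

Lemma nth_syzygy_pr k m M N : is_nth_syzygy k M N -> proj_resolution (k + m) M ->
  proj_resolution m N.
Proof.
elim: k m N => [|k IH] m N; first exact: pr_iso.
move=> [K MK [P [f [g [[P_proj _ _] fg]]]]]; rewrite addSnnS => /(IH _ _ MK).
exact: pr_ker fg.
Qed.

Lemma pr_nth_syzygy k m M N : is_nth_syzygy k M N -> proj_resolution m N ->
  proj_resolution (k + m) M.
Proof.
elim: k m N => [|k IH] m N; first by move=> /liso_sym; apply: pr_iso.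
move=> [K MK [P [f [g [[P_proj _ _] fg]]]]] N_res; rewrite addSnnS.
by apply: (IH _ _ MK); exists P, N, f, g.
Qed.

(** A section of the cover is onto because the cover is essential, so the cover is injective. *)
Lemma syzygy_proj M K : projective M -> is_syzygy M K -> zero_mod K.
Proof.
move=> M_proj [P [f [g [[_ _ ess] /short_exactP[f_inj gf _ g_onto]]]]] x.
have [s sE] := proj_lift (lid M) M_proj g_onto.
have /ontoP s_onto : range s = setT.
  by apply: ess; apply/ontoP => y; exists y; apply: sE.
have [y yE] := s_onto (f x); apply: f_inj.
by rewrite linear0 -yE -[y]sE yE gf linear0.
Qed.

Lemma nth_syzygy_zero m M N : proj_resolution m M -> is_nth_syzygy m.+1 M N ->
  zero_mod N.
Proof.
move=> M_res [K MK KN]; apply: syzygy_proj KN.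
by apply: (nth_syzygy_pr (m := 0) MK); rewrite addn0.
Qed.

End ProjectiveDimension.

(** * The first two layers as summands of extensions *)

Section Layers.
Context {A : pzRingType}.
Implicit Types K M N X Z T : lmodType A.

Lemma se_iso K M N K' M' N' (f : {linear K -> M}) (g : {linear M -> N}) :
  short_exact f g -> linear_iso K K' -> linear_iso M M' -> linear_iso N N' ->
  exists (f' : {linear K' -> M'}) (g' : {linear M' -> N'}), short_exact f' g'.
Proof.
move=> /short_exactP[f_inj gf gK g_onto].
move=> /liso_ex[a [a' [aK aK']]] /liso_ex[b [b' [bK bK']]] /liso_ex[c [c' [cK cK']]].
exists (lcomp b (lcomp f a')), (lcomp c (lcomp g b')).
apply/short_exactP; split=> [x y /= /(can_inj bK)/f_inj/(can_inj aK')//|x|y|z] /=.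
- by rewrite bK gf linear0.
- rewrite -(linear0 c) => /(can_inj cK)/gK[x xE].
  by exists (a x); rewrite aK xE bK'.
- have [y yE] := g_onto (c' z); by exists (b y); rewrite bK yE cK'.
Qed.

Lemma se_prod K M N K' M' N' (f : {linear K -> M}) (g : {linear M -> N})
    (f' : {linear K' -> M'}) (g' : {linear M' -> N'}) :
  short_exact f g -> short_exact f' g' -> short_exact (lprod f f') (lprod g g').
Proof.
move=> /short_exactP[f_inj gf gK g_onto] /short_exactP[f_inj' gf' gK' g_onto'].
apply/short_exactP.
split=> [[x x'] [y y'] /= [/f_inj -> /f_inj' ->]//|[x x']|[y y']|[z z']] /=.
- by rewrite gf gf'.
- by move=> [/gK[x <-] /gK'[x' <-]]; exists (x, x').
- by have [[y <-] [y' <-]] := (g_onto z, g_onto' z'); exists (y, y').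
Qed.

(* A module of size at most 1 is only a summand of an extension of sums of
   copies of [T]; the complement [Z] need not have finite projective dimension. *)
Definition ext_summand T X := exists a b Z (i : {linear dsum (fun=> T) a -> (X * Z)%type})
  (p : {linear (X * Z)%type -> dsum (fun=> T) b}), short_exact i p.

Lemma dsum_eq T (F : nat -> lmodType A) n : (forall i, (i < n)%N -> T = F i) ->
  linear_iso (dsum F n) (dsum (fun=> T) n).
Proof. by move=> FT; apply: dsum_iso => i /FT <-; apply: liso_refl. Qed.

(** Adding the split sequence on the complements [C1] and [C2] turns the outer terms into powers of
    [T]. *)
Lemma ext_summand_ext T X M1 M2 (f : {linear M1 -> X}) (g : {linear X -> M2}) :
  Defs.add (eq T) M1 -> Defs.add (eq T) M2 -> short_exact f g -> ext_summand T X.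
Proof.
move=> [_ [a [F [FT [C1 M1E]]]]] [_ [b [G [GT [C2 M2E]]]]] fg.
have {}M1E := liso_trans M1E (dsum_eq FT).
have {}M2E := liso_trans M2E (dsum_eq GT).
have C1C2 : short_exact (linl C1 C2) (lsnd C1 C2).
  apply/short_exactP; split=> [x y []//|//|[x y] /= ->|y]; first by exists x.
  by exists (0, y).
have [i [p ip]] := se_iso (se_prod fg C1C2) M1E (liso_refl _) M2E.
by exists a, b, (C1 * C2)%type, i, p.
Qed.

Lemma ext_summand_dsum T (F : nat -> lmodType A) n :
  (forall i, (i < n)%N -> ext_summand T (F i)) -> ext_summand T (dsum F n).
Proof.
elim: n => [|n IH] FT.
  exists 0%N, 0%N, 'rV[A]_0, (lzero _ _), (lzero _ _); apply/short_exactP.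
  split=> [x y _|//|[x y] _|y].
  - by rewrite (zero_rV0 x) (zero_rV0 y).
  - by exists 0; rewrite (zero_rV0 x) (zero_rV0 y).
  - by exists 0; rewrite (zero_rV0 y).
have [|a [b [Z [i [p ip]]]]] := IH; first by move=> i /ltnW; apply: FT.
have [//|a' [b' [Z' [i' [p' ip']]]]] := FT n.
have [i2 [p2 ip2]] := se_iso (se_prod ip ip') (dsum_const_add _ _ _)
  (liso_prodACA _ _ _ _) (dsum_const_add _ _ _).
by exists (a + a')%N, (b + b')%N, (Z * Z')%type, i2, p2.
Qed.

Lemma ext_summand_retract T M N X : linear_iso (M * N)%type X ->
  ext_summand T X -> ext_summand T M.
Proof.
move=> MNX [a [b [Z [i [p ip]]]]].
have XZ : linear_iso (X * Z)%type (M * (N * Z))%type.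
  apply: liso_trans (liso_prod (liso_sym MNX) (liso_refl Z)) _.
  exact/liso_sym/liso_prodA.
have [i2 [p2 ip2]] := se_iso ip (liso_refl _) XZ (liso_refl _).
by exists a, b, (N * Z)%type, i2, p2.
Qed.

Lemma layer_ext_summand T k M : (k <= 1)%N -> layer T k.+1 M -> ext_summand T M.
Proof.
have zero_ext (X : lmodType A) : zero_mod X -> Defs.add (eq T) X.
  move=> X0; split.
    by have [] := fgp_zero X0.
  exists 0%N, (fun=> T); split=> //; exists 'rV[A]_0.
  apply: liso_trans (liso_prodr0 _ (@zero_rV0 A)) _.
  by apply: liso_zero => //; apply: zero_rV0.
case: k => [|[|//]] _ /=.
  move=> MT; apply: (ext_summand_ext (f := lid M) (g := lzero M 'rV[A]_0)) => //.
    exact/zero_ext/zero_rV0.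
  apply/short_exactP; split=> // [y _|y]; first by exists y.
  by exists 0; rewrite (zero_rV0 y).
move=> [_ [n [F [FT [N MN]]]]]; apply: ext_summand_retract MN _.
apply: ext_summand_dsum => i /FT[_ [M1 [M2 [f [g [M1T M2T fg]]]]]].
exact: ext_summand_ext fg.
Qed.

End Layers.

(** * The uniform bound on projective dimensions *)

Section FinitisticDimension.
Context {R : comPzRingType} {A : pzRingType} (phi : {rmorphism R -> A}).
Hypothesis phi_artin : artin_algebra phi.
Implicit Types K M N P Q X Y T : lmodType A.

Lemma pr_stable0 n M : fin_gen M -> proj_resolution n M -> stable0 n (lid M).
Proof.
elim: n M => [|n IH] M M_fg M_res; first by exists M, (lid M), (lid M).
have [K [P [f [g fg]]]] := cover_ex M_fg.
apply: (stable0_mk fg fg (over_id f g)); apply: IH.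
  exact: (cover_fg phi_artin fg).
exact: pr_ker fg.1.1 fg.2 M_res.
Qed.

Lemma stable0_pr n M : fin_gen M -> stable0 n (lid M) -> proj_resolution n M.
Proof.
elim: n M => [|n IH] M M_fg M0; first exact: stable0_id0.
have [K [P [f [g fg]]]] := cover_ex M_fg; have K_fg := cover_fg phi_artin fg.
exists P, K, f, g; split; [by case: fg => -[]|by case: fg|].
by apply: (IH _ K_fg); apply: (stable0_over phi_artin fg fg.2 K_fg (over_id f g)) M0.
Qed.

Lemma nth_syzygy_ex n M : fin_gen M -> exists2 N, fin_gen N & is_nth_syzygy n M N.
Proof.
elim: n => [|n IH] M_fg; first by exists M => //; apply: liso_refl.
have [K K_fg MK] := IH M_fg; have [P [g [P_fgp g_cover]]] := proj_cover_ex phi_artin K_fg.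
have [N [f fg]] : exists N (f : {linear N -> P}), short_exact f g.
  by apply: ker_ex; apply/ontoP; case: g_cover.
exists N; first by apply: (cover_fg phi_artin (f := f) (g := g)).
by exists K => //; exists P, f, g.
Qed.

Lemma fg_ext K M N (f : {linear K -> M}) (g : {linear M -> N}) :
  short_exact f g -> fin_gen K -> fin_gen N -> fin_gen M.
Proof.
move=> /short_exactP[_ _ gK g_onto] K_fg /fg_free[n [h h_onto]].
have [h' hE] := proj_lift h (@proj_free _ n) g_onto.
apply: (fg_onto (g := lcopair f h')); last exact: fg_prod K_fg (fg_rV n).
move=> y; have [z zE] := h_onto (g y).
have [x xE] : exists x, f x = y - h' z by apply: gK; rewrite linearB hE zE subrr.
by exists (x, z); rewrite /= xE subrK.
Qed.

(** The projection [e] of [M * Z] onto [M] factors through [M], so it dies in high syzygies whatever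
    [Z] is. [ext_bound] bounds the level, and restricting [e] to [M] gives back the identity. *)
Lemma summand_bound T : fin_gen T -> exists c, forall M r, fin_gen M ->
  ext_summand T M -> proj_resolution r M -> proj_resolution c M.
Proof.
move=> T_fg; have [c cP] := ext_bound phi_artin T_fg.
exists c => M r M_fg [a [b [Z [i [p ip]]]]] /(pr_stable0 M_fg) M0.
have MZ_fg : fin_gen (M * Z)%type by apply: fg_ext ip _ _; apply: fg_dsum.
pose e := lcomp (linl M Z) (lcomp (lid M) (lfst M Z)).
have e0 : stable0 c e.
  apply: (cP a b _ i p e r ip) => //.
  exact: (stable0_comp phi_artin _ _ MZ_fg MZ_fg M0).
apply: stable0_pr => //.
have := stable0_comp phi_artin (linl M Z) (lfst M Z) M_fg M_fg e0.
exact: stable0_ext.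
Qed.

End FinitisticDimension.

(** * Passage to the converse ring, and the equivalence *)

Section Opposite.
Context {R : comPzRingType} {L : pzRingType} (phi : {rmorphism R -> L}).
Hypothesis phi_artin : artin_algebra phi.

(* The structure map is central, so it is also a morphism to the converse ring. *)
Definition opp_morphism (r : R) : L^c := phi r.

Fact opp_morphism_zmod : zmod_morphism opp_morphism.
Proof. by move=> x y; apply: (rmorphB phi). Qed.

Fact opp_morphism_monoid : monoid_morphism opp_morphism.
Proof.
split=> [|x y]; first exact: (rmorph1 phi).
by rewrite mulrC; apply: (rmorphM phi).
Qed.

HB.instance Definition _ :=
  GRing.isZmodMorphism.Build R L^c opp_morphism opp_morphism_zmod.
HB.instance Definition _ :=
  GRing.isMonoidMorphism.Build R L^c opp_morphism opp_morphism_monoid.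

Lemma artin_algebra_opp : artin_algebra (opp_morphism : {rmorphism R -> L^c}).
Proof.
have [artR comm [n [e eP]]] := phi_artin; split=> // [r x|].
  by rewrite -[LHS]/((x : L) * phi r) -[RHS]/(phi r * (x : L)) comm.
exists n, e => x; have [c ->] := eP x; exists c; apply: eq_bigr => i _.
exact: comm.
Qed.

End Opposite.

Theorem proposition3p11 (R : comPzRingType) (L : pzRingType)
    (phi : {rmorphism R -> L}) (hL : artin_algebra phi) :
  (fin_dim L < +oo)%E <->
  exists n : nat, (size_mod (Omega n (@Pfin L)) <= 1)%E.
Proof.
have psi_artin := artin_algebra_opp hL.
have PfinP (M : lmodType L^c) :
    Pfin M <-> fin_gen M /\ exists n, proj_resolution n M.
  by split=> -[M_fg /inf_nat_lty].
rewrite /fin_dim /sup_enat; split.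
  (* Minimal syzygies vanish one step past the projective dimension, and zero modules lie in the
     first layer of [T = 0]. *)
  move=> /inf_nat_lty[m m_ub]; exists m.+1; apply/(inf_nat_le _ 1).
  exists 0%N => //; exists 'rV[L^c]_0; first exact: fg_rV.
  move=> N [M M_fin MN].
  have N0 : zero_mod N.
    have /(inf_nat_le _ m)[k km M_res] : (pd M <= m%:Z%:E)%E by apply: m_ub; exists M.
    exact: nth_syzygy_zero (pr_le km M_res) MN.
  split; first by have [] := fgp_zero N0.
  exists 0%N, (fun=> N); split=> //; exists 'rV[L^c]_0.
  apply: liso_trans (liso_prodr0 _ (@zero_rV0 _)) _.
  by apply: liso_zero => //; apply: zero_rV0.
move=> [n /(inf_nat_le _ 1)[k k1 [T T_fg T_layer]]]; apply/inf_nat_lty.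
have [c cP] := summand_bound psi_artin T_fg.
(* [n] syzygies lead into the class of size at most 1, where [c] bounds the projective dimension. *)
exists (n + c)%N => _ [M M_fin ->]; apply/inf_nat_le; exists (n + c)%N => //.
have [M_fg [r M_res]] := (PfinP M).1 M_fin.
have [Y Y_fg MY] := nth_syzygy_ex psi_artin n M_fg.
apply: (pr_nth_syzygy MY); apply: (cP Y r Y_fg).
  by apply: (layer_ext_summand k1); apply: T_layer; exists M.
exact: (nth_syzygy_pr MY (pr_le (leq_addl n r) M_res)).
Qed.
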